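(* Let $k$ be a field and let $M$ be a regular matroid of rank $r$ with a standard ordering $e_1<\cdots<e_n$ of its ground set (i.e. $B=\{e_{n-r+1},\ldots,e_n\}$ is a basis), and suppose $\{e_n,e_{n-r}\}$ is a cocircuit of $M$. If $M\setminus e_n$ and $M/e_n$ have NBC bases in their induced standard orderings (the restriction of $e_1<\cdots<e_n$ to $e_1<\cdots<e_{n-1}$, with bases $\{e_{n-r},\ldots,e_{n-1}\}$ and $\{e_{n-r+1},\ldots,e_{n-1}\}$ respectively), then $M$ has an NBC basis in the ordering $e_1<\cdots<e_n$.
   Context: Let $N$ be a regular matroid of rank $s$ on $e_1<\cdots<e_m$ with $B=\{e_{m-s+1},\ldots,e_m\}$ a basis. For $e\notin B$, $\mathrm{ci}(B,e)$ is the unique circuit in $B\cup\{e\}$; for $b\in B$, $\mathrm{coc}(B,b)$ is the unique cocircuit in $(E\setminus B)\cup\{b\}$ containing $b$. Fix an admissible signed fundamental cocircuit incidence matrix $(a^*_{ji})$ (rows $\mathrm{coc}(B,e_j)$, $0/\pm1$ entries, being the restriction of a signing of the full cocircuit incidence matrix that together with some signing of the full circuit incidence matrix satisfies $\widetilde{\mathcal{A}}(\mathcal{C})\widetilde{\mathcal{A}}(\mathcal{C}^* )^T=0$ over $k$). Let $\Theta^B=\{\theta_{e_j}=\sum_{e_i\in\mathrm{coc}(B,e_j)}a^*_{ji}x_i : e_j\in B\}$ and $k(\Delta_{\mathrm{BC}}(N))=k[\Delta_{\mathrm{BC}}(N)]/(\Theta^B)$, where $\Delta_{\mathrm{BC}}(N)$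 is the broken circuit complex (sets containing no $\overline{C}=C\setminus\{\min C\}$, $C$ a circuit) and $k[\Delta_{\mathrm{BC}}(N)]=k[x_1,\ldots,x_m]/\langle\prod_{e_i\in\overline{C}}x_i\rangle$. Label circuits so that $C_i=\mathrm{ci}(B,e_i)$ for $i\le m-s$, others $C_{m-s+1},\ldots$. Set $d_j=j$ for $j\le m-s$ and $d_j=\min\{i:e_i\in\mathrm{coc}(B,e_j)\}$ for $j>m-s$; $m_{C_i}=x_i^{|\overline{C}_i|}$ if $i\le m-s$, $m_{C_i}=\prod_{e_j\in\overline{C}_i}x_{d_j}$ otherwise. Let $L(N)$ be the set of monomials in $x_1,\ldots,x_{m-s}$ not divisible by any $m_C$. $N$ has an NBC basis in this ordering if the images of $L(N)$ form a $k$-basis of $k(\Delta_{\mathrm{BC}}(N))$. $M\setminus e$ is the deletion (independent sets of $M$ avoiding $e$) and $M/e$ the contraction (bases $B'$ with $B'\cup\{e\}$ a basis of $M$). *)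

(* Defs.v *)
From HB Require Import structures.
From mathcomp Require Import all_boot all_order all_algebra.
From mathcomp Require Import mpoly.
Set Implicit Arguments. Unset Strict Implicit. Unset Printing Implicit Defensive.
Import Order.TTheory GRing.Theory.
Local Open Scope ring_scope.

(* Ground set E = {e_1 < ... < e_m} is 'I_m, with e_{i+1} <-> ordinal i.
   A matroid is given by its independence predicate. *)

Section Matroids.
Variable m : nat.
Implicit Types (N : {set 'I_m} -> bool) (S C D : {set 'I_m}).

Definition is_matroid N : Prop :=
  [/\ N set0,
      (forall S T : {set 'I_m}, S \subset T -> N T -> N S) &
      (forall S T : {set 'I_m}, N S -> N T -> #|S| < #|T| ->
         exists2 x, x \in T :\: S & N (x |: S))]%N.

Definition totally_unimodular (p : nat) (A : 'M[rat]_(p, m)) : Prop :=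
  forall (q : nat) (f : 'I_q -> 'I_p) (g : 'I_q -> 'I_m),
    \det (mxsub f g A) \in [:: 0; 1; -1].

Definition represents (p : nat) (A : 'M[rat]_(p, m)) N : Prop :=
  forall S, N S = (\rank (\matrix_(i, j) (if j \in S then A i j else 0)) == #|S|).

Definition regular N : Prop :=
  exists p (A : 'M[rat]_(p, m)), totally_unimodular A /\ represents A N.

Definition mbasis N S : bool :=
  N S && [forall T : {set 'I_m}, (S \subset T) && N T ==> (T == S)].

Definition circuit N C : bool :=
  ~~ N C && [forall D : {set 'I_m}, (D \proper C) ==> N D].

Definition meets_all_bases N D : bool :=
  [forall B : {set 'I_m}, mbasis N B ==> (D :&: B != set0)].
Definition cocircuit N D : bool :=
  meets_all_bases N D &&
  [forall D' : {set 'I_m}, (D' \proper D) ==> ~~ meets_all_bases N D'].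

Definition broken C : {set 'I_m} := [set x in C | [exists y in C, y < x]%N].

Definition Bst (s : nat) : {set 'I_m} := [set i : 'I_m | m - s <= i]%N.

Definition ci N (B : {set 'I_m}) (e : 'I_m) : {set 'I_m} :=
  odflt set0 [pick C | circuit N C && (C \subset e |: B) && (e \in C)].
Definition coc N (B : {set 'I_m}) (b : 'I_m) : {set 'I_m} :=
  odflt set0 [pick D | cocircuit N D && (D \subset b |: ~: B) && (b \in D)].

Variable k : fieldType.

(* admissible signed fundamental cocircuit incidence matrix (rows coc(B,e_j),
   j in B), as restriction of a signing sd of the full cocircuit incidence
   matrix orthogonal over k to a signing sc of the full circuit incidence
   matrix *)
Definition admissible N (s : nat) (a : 'I_m -> 'I_m -> k) : Prop :=
  exists (sc sd : {set 'I_m} -> 'I_m -> k),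
    [/\ (forall C, circuit N C -> forall e,
           (e \notin C -> sc C e = 0) /\ (e \in C -> sc C e = 1 \/ sc C e = -1)),
        (forall D, cocircuit N D -> forall e,
           (e \notin D -> sd D e = 0) /\ (e \in D -> sd D e = 1 \/ sd D e = -1)),
        (forall C D, circuit N C -> cocircuit N D ->
           \sum_(e : 'I_m) sc C e * sd D e = 0) &
        (forall j, j \in Bst s -> forall i, a j i = sd (coc N (Bst s) j) i)].

Definition theta N (s : nat) (a : 'I_m -> 'I_m -> k) (j : 'I_m) : {mpoly k[m]} :=
  \sum_(i in coc N (Bst s) j) a j i *: 'X_i.

Definition gens N (s : nat) (a : 'I_m -> 'I_m -> k) (p : {mpoly k[m]}) : Prop :=
  (exists C, circuit N C /\ p = \prod_(i in broken C) 'X_i) \/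
  (exists j, j \in Bst s /\ p = theta N s a j).

Definition in_ideal (G : {mpoly k[m]} -> Prop) (p : {mpoly k[m]}) : Prop :=
  exists r : seq ({mpoly k[m]} * {mpoly k[m]}),
    (forall q, q \in r -> G q.2) /\ p = \sum_(q <- r) q.1 * q.2.

Definition dd N (s : nat) (j : 'I_m) : 'I_m :=
  if (j < m - s)%N then j
  else odflt j [pick i in coc N (Bst s) j |
                 [forall i' : 'I_m, (i' \in coc N (Bst s) j) ==> (i <= i')%N]].

Definition mC N (s : nat) (C : {set 'I_m}) : 'X_{1..m} :=
  if [pick i : 'I_m | (i < m - s)%N && (C == ci N (Bst s) i)] is Some i
  then (U_(i) *+ #|broken C|)%MM
  else (\sum_(j in broken C) U_(dd N s j))%MM.

Definition inL N (s : nat) (mm : 'X_{1..m}) : bool :=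
  [forall i : 'I_m, (m - s <= i)%N ==> (mm i == 0%N)] &&
  [forall C : {set 'I_m}, circuit N C ==> ~~ (mC N s C <= mm)%MM].

(* images of L(N) form a k-basis of k[x]/(I_Delta + (Theta^B)) *)
Definition NBC_basis_for N (s : nat) (a : 'I_m -> 'I_m -> k) : Prop :=
  (forall p : {mpoly k[m]}, (forall mm, mm \in msupp p -> inL N s mm) ->
     in_ideal (gens N s a) p -> p = 0) /\
  (forall f : {mpoly k[m]}, exists2 p : {mpoly k[m]},
     (forall mm, mm \in msupp p -> inL N s mm) & in_ideal (gens N s a) (f - p)).

Definition has_NBC_basis N (s : nat) : Prop :=
  forall a : 'I_m -> 'I_m -> k, admissible N s a -> NBC_basis_for N s a.

End Matroids.

Definition del_last (n : nat) (M : {set 'I_n.+1} -> bool) : {set 'I_n} -> bool :=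
  fun S => M (widen_ord (leqnSn n) @: S).

Definition con_last (n : nat) (M : {set 'I_n.+1} -> bool) : {set 'I_n} -> bool :=
  fun S => [exists B' : {set 'I_n},
    (S \subset B') && mbasis M (ord_max |: (widen_ord (leqnSn n) @: B'))].

(* Main.v *)
Require Import Defs.
From HB Require Import structures.
From mathcomp Require Import all_boot all_order all_algebra.
From mathcomp Require Import mpoly ring.
Set Implicit Arguments. Unset Strict Implicit. Unset Printing Implicit Defensive.
Import Order.TTheory GRing.Theory.
Local Open Scope ring_scope.

(** Write [top] for the last element and [u] for its partner in the series pair
    [{u, top}], so that [x_top = c x_u] modulo [Theta]. Since every circuit
    contains both or none of [u] and [top], the monomials split as
    [L(M) = L(M \ top) + x_u L(M / top)], and setting [x_top] to [0], resp.
    multiplying by [x_u], gives a right exact sequence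
    [k(M / top) -> k(M) -> k(M \ top) -> 0]: the images of [L(M)] span.

    Independence amounts to injectivity of the first map, i.e. to the fact that
    the linear forms in [Theta] behave like a regular sequence on the broken
    circuit rings. This is proved for an arbitrary set [K] of linear relations
    on the variables and arbitrary linear forms orthogonal to [K], by
    deleting and contracting the last variable; the circuit signing provides
    such a [K], namely the vectors orthogonal to all signed cocircuits. *)



(** No dimension count enters: the kernel of multiplication by [x_u] is computed directly. Since
    [x_top] is a nonzero multiple of [x_u] modulo the ideal, the question is the colon of the ideal
    by the last variable, and the last variable is where deletion and contraction act well on broken
    circuits, because the largest element of a circuit with two elements never is its minimum.

    The colon argument has to move linear forms past [x_e], so it needs them to be nonzerodivisors,
    and this needs the colon argument for fewer variables. The obstacle is that fixed fundamental
    forms do not survive the recursion. After deletion of [e] the relations vanish at [e], so [x_e]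
    becomes one more orthogonal form and killing it means adjoining it; after contraction the forms
    are orthogonal only after a change of coordinates. Hence the statement ranges over all families
    of forms orthogonal to [K], and over all [K]. The ring keeps its [m] variables throughout; only
    the bound [t] on the supports shrinks.

    On the matroid side, the facts relating circuits to cocircuits are read off the orthogonal
    signings: a circuit and a cocircuit with a single common element would leave a sum with one
    nonzero term. *)

Section Ideals.
Variables (k : fieldType) (m : nat).
Implicit Types (G H : {mpoly k[m]} -> Prop) (p q : {mpoly k[m]}).

Lemma in_ideal_gen G g : G g -> in_ideal G g.
Proof.
move=> Gg; exists [:: (1, g)]; split; first by move=> q; rewrite inE => /eqP->.
by rewrite big_seq1 mul1r.
Qed.

Lemma in_ideal0 G : in_ideal G 0.
Proof. by exists [::]; split => //; rewrite big_nil. Qed.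

Lemma in_idealD G p q : in_ideal G p -> in_ideal G q -> in_ideal G (p + q).
Proof.
move=> [r1 [h1 ->]] [r2 [h2 ->]]; exists (r1 ++ r2); split; last by rewrite big_cat.
by move=> t; rewrite mem_cat => /orP[/h1|/h2].
Qed.

Lemma in_idealMl G p q : in_ideal G q -> in_ideal G (p * q).
Proof.
move=> [r [h ->]]; exists [seq (p * t.1, t.2) | t <- r]; split.
  by move=> t /mapP[t' /h Gt' ->].
by rewrite big_map mulr_sumr; apply: eq_bigr => t _; rewrite mulrA.
Qed.

Lemma in_idealMr G p q : in_ideal G q -> in_ideal G (q * p).
Proof. by rewrite mulrC; apply: in_idealMl. Qed.

Lemma in_idealZ G c q : in_ideal G q -> in_ideal G (c *: q).
Proof. by rewrite -mul_mpolyC; apply: in_idealMl. Qed.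

Lemma in_idealB G p q : in_ideal G p -> in_ideal G q -> in_ideal G (p - q).
Proof. by move=> hp hq; apply: in_idealD => //; rewrite -mulN1r; apply: in_idealMl. Qed.

Lemma in_ideal_sum G (I : Type) (r : seq I) (P : pred I) (F : I -> {mpoly k[m]}) :
  (forall i, P i -> in_ideal G (F i)) -> in_ideal G (\sum_(i <- r | P i) F i).
Proof.
move=> h; apply: (big_ind (in_ideal G)) => //; first exact: in_ideal0.
by move=> x y; apply: in_idealD.
Qed.

Lemma in_ideal_eqmod G p q : in_ideal G (p - q) -> in_ideal G q -> in_ideal G p.
Proof. by move=> h1 h2; rewrite -(subrK q p); apply: in_idealD. Qed.

(** Turns membership modulo [x] into an explicit cofactor [h] of [x]; the later arguments work on
    this cofactor. *)
Lemma in_ideal_adjoin G H x p :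
  (forall g, G g -> H g \/ exists c, in_ideal H (g - x * c)) ->
  in_ideal G p -> exists h, in_ideal H (p - x * h).
Proof.
move=> GH [r [hr ->]] {p}; elim: r hr => [|[a g] r IH] hr.
  by exists 0; rewrite big_nil mulr0 subr0; apply: in_ideal0.
have [|h Hh] := IH; first by move=> q qr; apply: hr; rewrite inE qr orbT.
rewrite big_cons /=.
have [c Hc] : exists c, in_ideal H (g - x * c).
  have /GH : G g by apply: (hr (a, g)); rewrite inE eqxx.
  case=> // Hg; exists 0; rewrite mulr0 subr0; exact: in_ideal_gen.
exists (a * c + h); have -> : a * g + \sum_(j <- r) j.1 * j.2 - x * (a * c + h) =
   a * (g - x * c) + (\sum_(j <- r) j.1 * j.2 - x * h) by ring.
by apply: in_idealD => //; apply: in_idealMl.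
Qed.

End Ideals.

(** * Polynomial substitutions and ideals *)

Section Morphisms.
Variables (k : fieldType) (m m' : nat).

(** The factor [x] serves maps such as [p] to ['X_u * mwiden p], which are no ring morphisms but are
    still linear over one. *)
Lemma in_ideal_mul_morph (f : {rmorphism {mpoly k[m]} -> {mpoly k[m']}}) x
    (G : {mpoly k[m]} -> Prop) (H : {mpoly k[m']} -> Prop) p :
  (forall g, G g -> in_ideal H (x * f g)) -> in_ideal G p -> in_ideal H (x * f p).
Proof.
move=> GH [r [hr ->]]; rewrite rmorph_sum mulr_sumr big_seq_cond.
apply: in_ideal_sum => t; rewrite andbT => /hr /GH Ht.
by rewrite rmorphM mulrCA; apply: in_idealMl.
Qed.

Lemma in_ideal_morph (f : {rmorphism {mpoly k[m]} -> {mpoly k[m']}})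
    (G : {mpoly k[m]} -> Prop) (H : {mpoly k[m']} -> Prop) p :
  (forall g, G g -> in_ideal H (f g)) -> in_ideal G p -> in_ideal H (f p).
Proof.
by move=> GH; rewrite -[f p]mul1r; apply: in_ideal_mul_morph => g /GH; rewrite mul1r.
Qed.

Definition psubst (h : 'I_m -> {mpoly k[m']}) : {mpoly k[m]} -> {mpoly k[m']} :=
  mmap (@mpolyC m' k) h.

HB.instance Definition _ h := GRing.RMorphism.on (psubst h).

Lemma psubstX h i : psubst h 'X_i = h i.
Proof. by rewrite /psubst mmapX mmap1U. Qed.

Lemma psubstZ h c p : psubst h (c *: p) = c *: psubst h p.
Proof. by rewrite /psubst mmapZ mul_mpolyC. Qed.

Lemma psubst_eqmod (H : {mpoly k[m']} -> Prop) h h' p :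
  (forall i, in_ideal H (h i - h' i)) -> in_ideal H (psubst h p - psubst h' p).
Proof.
move=> hh; rewrite /psubst /mmap -sumrB; apply: in_ideal_sum => mm _.
rewrite -mulrBr; apply: in_idealMl; rewrite /mmap1.
pose e (x y : {mpoly k[m']}) := in_ideal H (x - y).
have eM x1 y1 x2 y2 : e x1 y1 -> e x2 y2 -> e (x1 * x2) (y1 * y2).
  rewrite /e => h1 h2; have -> : x1 * x2 - y1 * y2 =
    x2 * (x1 - y1) + y1 * (x2 - y2) by ring.
  by apply: in_idealD; apply: in_idealMl.
have e1 : e 1 1 by rewrite /e subrr; apply: in_ideal0.
apply: (big_ind2 e e1 eM) => i _; elim: (mm i) => [|j IH]; first by rewrite !expr0.
by rewrite !exprS; apply: eM; [apply: hh | apply: IH].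
Qed.

End Morphisms.

Lemma in_ideal_sub (k : fieldType) m (G H : {mpoly k[m]} -> Prop) p :
  (forall g, G g -> in_ideal H g) -> in_ideal G p -> in_ideal H p.
Proof. exact: (@in_ideal_morph k m m idfun G H p). Qed.

Lemma psubst_id (k : fieldType) m (p : {mpoly k[m]}) : psubst (fun i => 'X_i) p = p.
Proof.
rewrite {2}[p]mpolyE /psubst /mmap; apply: eq_bigr => i _.
by rewrite mmap1_id mul_mpolyC.
Qed.

Lemma psubst_comp (k : fieldType) m1 m2 m3 (h : 'I_m1 -> {mpoly k[m2]})
    (h' : 'I_m2 -> {mpoly k[m3]}) p :
  psubst h' (psubst h p) = psubst (fun i => psubst h' (h i)) p.
Proof.
have psubstE m4 (g : 'I_m1 -> {mpoly k[m4]}) :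
  psubst g p = \sum_(mm <- msupp p) (p@_mm)%:MP * mmap1 g mm by [].
rewrite !psubstE rmorph_sum; apply: eq_bigr => mm _.
rewrite rmorphM /= /psubst mmapC; congr (_ * _).
rewrite /mmap1 rmorph_prod; apply: eq_bigr => i _.
by rewrite rmorphXn.
Qed.

Lemma psubst_ext (k : fieldType) m1 m2 (h h' : 'I_m1 -> {mpoly k[m2]}) :
  h =1 h' -> psubst h =1 psubst h'.
Proof.
move=> e p; rewrite /psubst /mmap; apply: eq_bigr => mm _.
by congr (_ * _); apply: eq_bigr => i _; rewrite e.
Qed.

(** * Linear forms as row vectors *)

Section Linear.
Variables (k : fieldType) (m : nat).
Implicit Types (K : 'rV[k]_m -> Prop) (U : 'M[k]_m) (v w z : 'rV[k]_m).

Definition linform v : {mpoly k[m]} := \sum_i v 0 i *: 'X_i.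
Definition vsupp z : {set 'I_m} := [set i | z 0 i != 0].
Definition sqfree (S : {set 'I_m}) : {mpoly k[m]} := \prod_(i in S) 'X_i.

Lemma linformD v w : linform (v + w) = linform v + linform w.
Proof. by rewrite /linform -big_split; apply: eq_bigr => i _; rewrite mxE scalerDl. Qed.

Lemma linformZ c v : linform (c *: v) = c *: linform v.
Proof. by rewrite /linform scaler_sumr; apply: eq_bigr => i _; rewrite mxE scalerA. Qed.

Lemma linform0 : linform 0 = 0.
Proof. by rewrite /linform big1 // => i _; rewrite mxE scale0r. Qed.

Lemma linformB v w : linform (v - w) = linform v - linform w.
Proof. by rewrite -scaleN1r linformD linformZ scaleN1r. Qed.

Lemma linform_sum (I : Type) (r : seq I) P (F : I -> 'rV[k]_m) :
  linform (\sum_(i <- r | P i) F i) = \sum_(i <- r | P i) linform (F i).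
Proof. exact: (big_morph linform linformD linform0). Qed.

Lemma linform_delta i : linform (delta_mx 0 i) = 'X_i.
Proof.
rewrite /linform (bigD1 i) //= mxE !eqxx scale1r big1 ?addr0 // => j ji.
by rewrite mxE (negbTE ji) andbF scale0r.
Qed.

Lemma linform_eq0 v : linform v = 0 -> v = 0.
Proof.
move=> e; apply/rowP => j; rewrite mxE.
have := congr1 (fun p : {mpoly k[m]} => p@_U_(j)) e.
rewrite /linform raddf_sum /= mcoeff0 (bigD1 j) //= mcoeffZ mcoeffX eqxx mulr1.
rewrite big1 ?addr0 // => i ij; rewrite mcoeffZ mcoeffX.
case: eqP => [/mnmP/(_ i)|_]; last by rewrite mulr0.
by rewrite !mnm1E eqxx eq_sym (negbTE ij).
Qed.

End Linear.


(** * Monomial ideals and broken sets *)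

Section MonomialIdeals.
Variables (k : fieldType) (m : nat).

Lemma in_monomial_idealP (A : 'X_{1..m} -> Prop) (p : {mpoly k[m]}) :
  in_ideal (fun q => exists2 a, A a & q = 'X_[a]) p <->
  forall mm, mm \in msupp p -> exists2 a, A a & (a <= mm)%MM.
Proof.
split=> [[r [hr ->]] mm|h].
  elim: r hr => [|[q g] r IH] hr; first by rewrite big_nil msupp0.
  rewrite big_cons /= => /msuppD_le; rewrite mem_cat => /orP[|]; last first.
    by apply: IH => x xr; apply: hr; rewrite inE xr orbT.
  have [a Aa /= ->] := hr (q, g) (mem_head _ _).
  rewrite (perm_mem (msuppMX _ _)) => /mapP[b _ ->]; exists a => //; exact: lem_addr.
rewrite [p]mpolyE big_seq_cond; apply: in_ideal_sum => mm; rewrite andbT => /h[a Aa le].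
apply: in_idealZ; rewrite -(submK le) mpolyXD.
by apply/in_idealMl/in_ideal_gen; exists a.
Qed.

Lemma sqfreeE (S : {set 'I_m}) : sqfree k S = 'X_[\sum_(i in S) U_(i)].
Proof. by rewrite /sqfree mprodXE. Qed.

Lemma mnm_sumUE (S : {set 'I_m}) i : (\sum_(j in S) U_(j))%MM i = (i \in S).
Proof.
rewrite mnm_sumE; case: (boolP (i \in S)) => iS.
  rewrite (bigD1 i) //= mnm1E eqxx big1 // => j /andP[_ ji].
  by rewrite mnm1E (negbTE ji).
rewrite big1 // => j jS; rewrite mnm1E; case: eqP => // ji.
by rewrite -ji jS in iS.
Qed.

Lemma sqfreeU1 e (S : {set 'I_m}) : e \notin S -> sqfree k (e |: S) = 'X_e * sqfree k S.
Proof. by move=> eS; rewrite /sqfree big_setU1. Qed.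

Lemma sqfree_sub (S T : {set 'I_m}) : S \subset T -> exists q, sqfree k T = q * sqfree k S.
Proof.
move=> ST; exists (sqfree k (T :\: S)).
by rewrite /sqfree (big_setID S) /= (setIidPr ST) mulrC.
Qed.

Lemma broken_sub (S T : {set 'I_m}) : S \subset T -> broken S \subset broken T.
Proof.
move=> ST; apply/subsetP => x; rewrite !inE => /andP[xS /exists_inP[y yS yx]].
by rewrite (subsetP ST) //=; apply/exists_inP; exists y => //; apply: (subsetP ST).
Qed.

Lemma broken_D1max (S : {set 'I_m}) (e : 'I_m) : (forall i, i \in S -> (i <= e)%N) ->
  broken (S :\ e) = broken S :\ e.
Proof.
move=> max; apply/setP => x; rewrite !inE -andbA; congr (_ && _).
case xS: (x \in S) => //=; apply/exists_inP/exists_inP => -[y]; last first.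
  move=> yS yx; exists y => //; rewrite !inE yS andbT; apply/eqP => ye.
  by move: yx; rewrite ye ltnNge max.
by rewrite !inE => /andP[_ yS] yx; exists y.
Qed.

(** A largest element that is not alone is not the minimum, and removing it leaves the minimum in
    place. *)
Lemma broken_max (S : {set 'I_m}) (e : 'I_m) : (forall i, i \in S -> (i <= e)%N) ->
  e \in S -> S :\ e != set0 -> broken S = e |: broken (S :\ e).
Proof.
move=> max eS /set0Pn[y]; rewrite !inE => /andP[ye yS].
rewrite broken_D1max // setD1K // !inE eS /=; apply/exists_inP; exists y => //.
by rewrite ltn_neqAle max // andbT; exact: ye.
Qed.

End MonomialIdeals.

(** * Broken circuit ideals of a set of linear relations *)

Section Relations.
Variables (k : fieldType) (m : nat).
Implicit Types (K : 'rV[k]_m -> Prop) (v w z : 'rV[k]_m) (t : nat) (e : 'I_m).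

(* [K] plays the role of the linear relations between the elements of the
   ground set: the vectors supported on [0, t) carry the broken circuits, and a
   non-minimal dependent set adds nothing to the ideal. *)
Definition bc_gens K t (p : {mpoly k[m]}) : Prop :=
  exists z, [/\ K z, z != 0, (forall i, i \in vsupp z -> (i < t)%N)
              & p = sqfree k (broken (vsupp z))].
Definition lin_gens n (U : 'M[k]_(n, m)) (p : {mpoly k[m]}) : Prop :=
  exists2 v, (v <= U)%MS & p = linform v.
Definition bclin_gens K t n (U : 'M[k]_(n, m)) (p : {mpoly k[m]}) : Prop :=
  bc_gens K t p \/ lin_gens U p.

Definition orth K n (U : 'M[k]_(n, m)) : Prop :=
  forall z, K z -> (U <= kermx z^T)%MS.

Definition drop_coord e z : 'rV[k]_m := z - z 0 e *: delta_mx 0 e.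
(** On relations, contraction projects a coordinate away, whereas deletion keeps the relations that
    vanish there. *)
Definition contract_rel K e z' : Prop := exists2 z, K z & z' = drop_coord e z.
Definition noloop K e : Prop := forall z, K z -> drop_coord e z = 0 -> z = 0.

Lemma drop_coordE e z i : drop_coord e z 0 i = if i == e then 0 else z 0 i.
Proof.
rewrite !mxE eqxx /=; case: eqP => [->|_]; first by rewrite mulr1 subrr.
by rewrite mulr0 subr0.
Qed.

Lemma drop_coord_id e z : z 0 e = 0 -> drop_coord e z = z.
Proof. by move=> ze; rewrite /drop_coord ze scale0r subr0. Qed.

Lemma vsupp_drop e z : vsupp (drop_coord e z) = vsupp z :\ e.
Proof. by apply/setP => i; rewrite !inE drop_coordE; case: (i == e); rewrite ?eqxx. Qed.

Lemma vsupp_eq0 z : (vsupp z == set0) = (z == 0).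
Proof.
apply/eqP/eqP => [h|->]; last by apply/setP => i; rewrite !inE mxE eqxx.
apply/rowP => i; rewrite mxE; apply/eqP; have := in_set0 i; rewrite -h inE.
by move/negbFE.
Qed.

Lemma bc_gens_le K t t' g : (t <= t')%N -> bc_gens K t g -> bc_gens K t' g.
Proof.
move=> tt [z [Kz nz sz ->]]; exists z; split=> // i /sz it; exact: leq_trans tt.
Qed.

Lemma bc_gens_sub K K' t g : (forall z, K z -> K' z) -> bc_gens K t g -> bc_gens K' t g.
Proof. by move=> KK' [z [/KK' Kz nz sz ->]]; exists z. Qed.

Lemma bc_gens_vanish K t g e : val e = t -> bc_gens K t g -> bc_gens (fun z => K z /\ z 0 e = 0) t g.
Proof.
move=> et [z [Kz nz sz ->]]; exists z; split=> //; split=> //.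
by apply/eqP; apply: contraT => ze; have := sz e; rewrite inE ze -et ltnn => ->.
Qed.

Lemma bc_gens_con K t g e : val e = t -> bc_gens K t g -> bc_gens (contract_rel K e) t g.
Proof.
move=> et /(bc_gens_vanish et) [z [[Kz ze] nz sz ->]]; exists z; split=> //.
by exists z; rewrite ?drop_coord_id.
Qed.

Lemma ltn_last e t (i : 'I_m) : val e = t -> (i < t.+1)%N -> i != e -> (i < t)%N.
Proof. by move=> <- it ie; rewrite ltn_neqAle -ltnS it andbT; apply: ie. Qed.

(** A relation nonzero at [e] has [e] as the largest index of its support. As it is not carried by
    [e] alone, [e] belongs to the broken set and ['X_e] splits off; what remains comes from the
    contracted relation. *)
Lemma bc_gens_split K t e g : val e = t -> noloop K e -> bc_gens K t.+1 g ->
  bc_gens K t g \/ exists2 g', bc_gens (contract_rel K e) t g' & g = 'X_e * g'.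
Proof.
move=> et nl [z [Kz nz sz ->]]; have [ze|ze] := eqVneq (z 0 e) 0.
  left; exists z; split=> // i iz; apply: (ltn_last et); first exact: sz.
  by apply/eqP => ie; move: iz; rewrite ie inE ze eqxx.
have nz' : drop_coord e z != 0 by apply: contra_neq nz => /nl; apply.
right; exists (sqfree k (broken (vsupp (drop_coord e z)))).
  exists (drop_coord e z); split=> //; first by exists z.
  move=> i; rewrite vsupp_drop !inE => /andP[ie iz]; apply: (ltn_last et) => //.
  by apply: sz; rewrite inE.
have max i : i \in vsupp z -> (i <= e)%N by move/sz; rewrite ltnS -et.
rewrite vsupp_drop (@broken_max _ _ e) ?inE //; last by rewrite -vsupp_drop vsupp_eq0.
by rewrite sqfreeU1 // broken_D1max // !inE eqxx.
Qed.

Lemma bc_gens_join K t e g : val e = t -> bc_gens (contract_rel K e) t g -> in_ideal (bc_gens K t.+1) ('X_e * g).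
Proof.
move=> et [z' [[z Kz zz] nz sz ->]]; have [ze|ze] := eqVneq (z 0 e) 0.
  apply/in_idealMl/in_ideal_gen; apply: (bc_gens_le (leqnSn t)); exists z'; split=> //.
  by rewrite zz drop_coord_id.
have szz i : i \in vsupp z -> (i < t.+1)%N.
  move=> iz; have [->|ie] := eqVneq i e; first by rewrite -et.
  by apply: ltnW; apply: sz; rewrite zz vsupp_drop !inE ie; rewrite inE in iz.
have max i : i \in vsupp z -> (i <= e)%N by move/szz; rewrite ltnS -et.
apply: in_ideal_gen; exists z; split=> //.
  by apply: contra_neq ze => ->; rewrite mxE.
rewrite zz vsupp_drop (@broken_max _ (vsupp z) e) ?inE //.
  by rewrite sqfreeU1 // broken_D1max // !inE eqxx.
by rewrite -vsupp_drop -zz vsupp_eq0.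
Qed.

Lemma in_ideal_bclin_gensS K t e n (U : 'M_(n, m)) h : val e = t ->
  in_ideal (bclin_gens (contract_rel K e) t U) h -> in_ideal (bclin_gens K t.+1 U) ('X_e * h).
Proof.
move=> et [r [hr ->]]; rewrite mulr_sumr big_seq_cond; apply: in_ideal_sum => q.
rewrite andbT mulrCA => /hr Gq; apply: in_idealMl; case: Gq => [/(bc_gens_join et)|Lq].
  by apply: in_ideal_sub => g Jg; apply: in_ideal_gen; left.
by apply/in_idealMl/in_ideal_gen; right.
Qed.

Lemma bclin_gens_mono K t n (U : 'M_(n, m)) K' t' n' (U' : 'M_(n', m)) p :
  (forall g, bc_gens K t g -> bc_gens K' t' g) -> (U <= U')%MS ->
  in_ideal (bclin_gens K t U) p -> in_ideal (bclin_gens K' t' U') p.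
Proof.
move=> KK UU; apply: in_ideal_sub => g [/KK h|[v vU ->]]; apply: in_ideal_gen.
  by left.
by right; exists v => //; apply: submx_trans UU.
Qed.

Lemma sub_adjP n (U : 'M[k]_(n, m)) v w : (v <= U + w)%MS ->
  exists c, (v - c *: w <= U)%MS.
Proof.
case/sub_addsmxP=> -[a b] ->; exists (b 0 0) => /=.
by rewrite {1}[b]mx11_scalar mul_scalar_mx addrK submxMl.
Qed.

Lemma bclin_gens_adjoin K t n (U : 'M[k]_(n, m)) w p :
  in_ideal (bclin_gens K t (U + w)%MS) p -> exists h, in_ideal (bclin_gens K t U) (p - linform w * h).
Proof.
apply: in_ideal_adjoin => g [Jg|[v vU ->]]; first by left; left.
right; have [c cU] := sub_adjP vU; exists c%:MP.
by rewrite mulrC mul_mpolyC -linformZ -linformB; apply/in_ideal_gen; right; exists (v - c *: w).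
Qed.

(** The generators only involve variables of index below [t], so none of them can use the factor
    ['X_e]. *)
Lemma monomial_colon K t e h : val e = t ->
  in_ideal (bc_gens K t) ('X_e * h) -> in_ideal (bc_gens K t) h.
Proof.
move=> et; pose A a := exists z, [/\ K z, z != 0, (forall i, i \in vsupp z -> (i < t)%N)
   & a = (\sum_(i in broken (vsupp z)) U_(i))%MM].
pose G (q : {mpoly k[m]}) := exists2 a, A a & q = 'X_[a].
have AJ p : in_ideal (bc_gens K t) p <-> in_ideal G p.
  split; apply: in_ideal_sub => g.
    move=> [z [Kz nz sz ->]]; apply: in_ideal_gen.
    by exists (\sum_(i in broken (vsupp z)) U_(i))%MM; [exists z | rewrite sqfreeE].
  move=> [a [z [Kz nz sz ->]] ->]; apply: in_ideal_gen.
  by exists z; split=> //; rewrite sqfreeE.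
move/AJ/in_monomial_idealP => H; apply/AJ/in_monomial_idealP => mm hm.
have [|a Aa le] := H (U_(e) + mm)%MM.
  by rewrite mulrC (perm_mem (msuppMX _ _)); apply: map_f.
exists a => //; apply/mnm_lepP => i; have := mnm_lepP le i.
rewrite mnmDE mnm1E; case: eqP => // <- _.
case: Aa => z [_ _ sz ->]; rewrite mnm_sumUE.
case: (boolP (e \in _)) => //; rewrite inE => /andP[/sz]; by rewrite -et ltnn.
Qed.

(** [w] is a nonzerodivisor modulo the broken circuits below [t] and the forms in [U]. Both [K] and
    [U] are quantified inside, since the induction on [t] changes them. *)
Definition linear_nzd t : Prop := forall K n (U : 'M[k]_(n, m)) w,
  orth K U -> orth K w -> ~~ (w <= U)%MS ->
  forall h, in_ideal (bclin_gens K t U) (linform w * h) -> in_ideal (bclin_gens K t U) h.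

Lemma orth_sub K K' n (U : 'M[k]_(n, m)) n' (U' : 'M[k]_(n', m)) :
  (forall z, K' z -> K z) -> (U' <= U)%MS -> orth K U -> orth K' U'.
Proof. by move=> KK UU oU z /KK/oU; apply: submx_trans. Qed.

Local Notation dlt e := (delta_mx 0 e : 'rV[k]_m).

(** This is what makes deletion an instance of the same statement: on relations vanishing at [e],
    the variable ['X_e] counts as an orthogonal form. *)
Lemma orth_vanish K e n (U : 'M[k]_(n, m)) : orth K U ->
  orth (fun z => K z /\ z 0 e = 0) (U + dlt e)%MS.
Proof.
move=> oU z [Kz ze]; rewrite addsmx_sub oU //=; apply/sub_kermxP.
by apply/matrixP => i j; rewrite -rowE !mxE !ord1 ze.
Qed.

(** Exchange: if [w] is a vector of [U] plus [c] times the unit vector, then [c = 0] puts [w] in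
    [U], and [c != 0] puts the unit vector in [U + w]. *)
Lemma notin_adjoin n (U : 'M[k]_(n, m)) w e :
  ~~ (w <= U)%MS -> ~~ (dlt e <= U + w)%MS -> ~~ (w <= U + dlt e)%MS.
Proof.
move=> wU; apply: contra => /sub_adjP[c cU].
have [c0|c0] := eqVneq c 0; first by rewrite c0 scale0r subr0 (negbTE wU) in cU.
rewrite -(eqmx_scale _ c0) -[c *: _](subKr w); apply: addmx_sub; first exact: addsmxSr.
by rewrite eqmx_opp; apply: submx_trans cU _; apply: addsmxSl.
Qed.

(** The deletion step. Supports below [t] avoid [e], so restricting [K] to relations vanishing at
    [e] loses no generator, and there regularity applies to [w] over [U] enlarged by ['X_e]. *)
Lemma linear_nzd_vanish t e K n (U : 'M[k]_(n, m)) w h : val e = t -> linear_nzd t ->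
  orth K U -> orth K w -> ~~ (w <= U)%MS -> ~~ (dlt e <= U + w)%MS ->
  in_ideal (bclin_gens K t (U + dlt e)%MS) (linform w * h) ->
  exists h1, in_ideal (bclin_gens K t U) (h - 'X_e * h1).
Proof.
move=> et Pt oU ow wU eU hh; rewrite -linform_delta; apply: bclin_gens_adjoin.
have {}hh : in_ideal (bclin_gens (fun z => K z /\ z 0 e = 0) t (U + dlt e)%MS) (linform w * h).
  by apply: bclin_gens_mono hh => // g; apply: bc_gens_vanish.
apply: (@bclin_gens_mono (fun z => K z /\ z 0 e = 0) t _ (U + dlt e)%MS) => //.
  by move=> g; apply: bc_gens_sub => z [].
apply: Pt hh; [exact: orth_vanish| |exact: notin_adjoin].
by apply: orth_sub ow => // z [].
Qed.

Lemma bclin_gens_kill K t e n (U : 'M[k]_(n, m)) p : val e = t -> noloop K e ->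
  in_ideal (bclin_gens K t.+1 U) p -> in_ideal (bclin_gens K t (U + dlt e)%MS) p.
Proof.
move=> et nl; apply: in_ideal_sub => g [/(bc_gens_split et nl)[Jg|[g' _ ->]]|[v vU ->]].
- by apply: in_ideal_gen; left.
- apply/in_idealMr/in_ideal_gen; right; exists (delta_mx 0 e); last by rewrite linform_delta.
  exact: addsmxSr.
- apply: in_ideal_gen; right; exists v => //; apply: submx_trans vU _; exact: addsmxSl.
Qed.

(* Induction on the number of forms: modulo [x_e] the coefficient of the last
   form [w] lies in the ideal of the others, by regularity after deletion, so
   that [h] can be corrected by a multiple of [w]. *)
Lemma colon_last_variable t e K : val e = t -> linear_nzd t -> noloop K e ->
  forall n (U : 'M[k]_(n, m)), orth K U -> ~~ (dlt e <= U)%MS ->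
  forall h, in_ideal (bclin_gens K t.+1 U) ('X_e * h) -> in_ideal (bclin_gens (contract_rel K e) t U) h.
Proof.
move=> et Pt nl; elim=> [|n IH] U oU eU h hh.
  have {}hh : in_ideal (bc_gens K t.+1) ('X_e * h).
    apply: in_ideal_sub hh => g [|[v]]; first exact: in_ideal_gen.
    by rewrite [U]flatmx0 => /submx0null-> ->; rewrite linform0; apply: in_ideal0.
  (* Without forms the ideal is monomial. The generators divisible by ['X_e] are collected into
     ['X_e * h']; the others do not involve ['X_e], which can then be cancelled. *)
  have [h' hh'] : exists h', in_ideal (bc_gens K t) ('X_e * h - 'X_e * h') /\
       in_ideal (bc_gens (contract_rel K e) t) h'.
    case: hh => r [hr ->]; elim: r hr => [|[q g] r IH] hr.
      by exists 0; rewrite big_nil mulr0 subr0; split; apply: in_ideal0.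
    have [|h' [h1 h2]] := IH; first by move=> x xr; apply: hr; rewrite inE xr orbT.
    rewrite big_cons /=; case: (bc_gens_split et nl (hr (q, g) (mem_head _ _))) => /=.
      move=> Jg; exists h'; split=> //; rewrite -addrA; apply: in_idealD => //.
      by apply/in_idealMl/in_ideal_gen.
    move=> [g' Jg' ->]; exists (q * g' + h'); split; last first.
      by apply: in_idealD => //; apply/in_idealMl/in_ideal_gen.
    by rewrite (_ : _ - _ = \sum_(j <- r) j.1 * j.2 - 'X_e * h') //; ring.
  case: hh'; rewrite -mulrBr => /(monomial_colon et) h1 h2.
  rewrite -(subrK h' h); apply: in_idealD.
    by apply: in_ideal_sub h1 => g /(bc_gens_con et) Jg; apply: in_ideal_gen; left.
  by apply: in_ideal_sub h2 => g Jg; apply: in_ideal_gen; left.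
pose w : 'rV_m := @usubmx _ 1 n m U; pose V : 'M_(n, m) := @dsubmx _ 1 n m U.
have UE : (U :=: V + w)%MS.
  rewrite (addsmxC V w); apply: (eqmx_trans _ (eqmx_sym (addsmxE w V))).
  by rewrite /w /V vsubmxK.
(* A first row depending on the others may be dropped, since [V] then spans the same forms with one
   row fewer. *)
have [wV|wV] := boolP (w <= V)%MS.
  have UV : (U <= V)%MS by rewrite UE addsmx_sub submx_refl.
  have VU : (V <= U)%MS by rewrite UE addsmxSl.
  apply: (@bclin_gens_mono (contract_rel K e) t _ V) => //; apply: IH.
  - exact: orth_sub oU.
  - by apply: contra eU => /submx_trans; apply.
  - exact: bclin_gens_mono hh.
have VU : (V <= U)%MS by rewrite UE addsmxSl.
have wU : (w <= U)%MS by rewrite UE addsmxSr.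
have oV : orth K V by apply: orth_sub oU.
have ow : orth K w by apply: orth_sub oU.
have [f hf] : exists f, in_ideal (bclin_gens K t.+1 V) ('X_e * h - linform w * f).
  by apply: bclin_gens_adjoin; apply: bclin_gens_mono hh; rewrite // UE.
have eV : ~~ (dlt e <= V + w)%MS by rewrite -UE.
have [f1 hf1] : exists f1, in_ideal (bclin_gens K t V) (f - 'X_e * f1).
  apply: (linear_nzd_vanish et Pt oV ow wV eV).
  have -> : linform w * f = 'X_e * h - ('X_e * h - linform w * f) by ring.
  apply: in_idealB; last exact: bclin_gens_kill hf.
  apply/in_idealMr/in_ideal_gen; right; exists (delta_mx 0 e); last by rewrite linform_delta.
  exact: addsmxSr.
have : in_ideal (bclin_gens (contract_rel K e) t V) (h - linform w * f1).
  apply: IH => //; first by apply: contra eU => /submx_trans; apply.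
  have -> : 'X_e * (h - linform w * f1) =
    ('X_e * h - linform w * f) + linform w * (f - 'X_e * f1) by ring.
  apply: in_idealD => //; apply: in_idealMl; apply: bclin_gens_mono hf1 => // g.
  exact: bc_gens_le.
move/(bclin_gens_mono (fun g Jg => Jg) VU) => hh'; apply: in_ideal_eqmod hh' _.
by apply/in_idealMr/in_ideal_gen; right; exists w.
Qed.
End Relations.


(** * Orthogonal linear forms are nonzerodivisors *)

Section Regularity.
Variables (k : fieldType) (m : nat).
Implicit Types (K : 'rV[k]_m -> Prop) (v w z : 'rV[k]_m) (t : nat) (e : 'I_m).
Local Notation dlt e := (delta_mx 0 e : 'rV[k]_m).

Definition lsubst (T : 'M[k]_m) : {mpoly k[m]} -> {mpoly k[m]} :=
  psubst (fun i => linform (row i T)).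

HB.instance Definition _ T := GRing.RMorphism.on (lsubst T).

Lemma lsubst_linform T v : lsubst T (linform v) = linform (v *m T).
Proof.
rewrite {1}/linform rmorph_sum mulmx_sum_row linform_sum; apply: eq_bigr => i _.
by rewrite /= /lsubst psubstZ psubstX linformZ.
Qed.

Lemma lsubst_comp T S p : lsubst S (lsubst T p) = lsubst (T *m S) p.
Proof.
rewrite /lsubst psubst_comp; apply: psubst_ext => i /=.
by rewrite -/(lsubst S) lsubst_linform row_mul.
Qed.

Lemma lsubst1 p : lsubst 1%:M p = p.
Proof.
rewrite -[RHS]psubst_id; apply: psubst_ext => i.
by rewrite rowE mulmx1 linform_delta.
Qed.

Lemma lsubst_eqmod (H : {mpoly k[m]} -> Prop) T p :
  (forall i, in_ideal H ('X_i - linform (row i T))) -> in_ideal H (p - lsubst T p).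
Proof. by move=> h; rewrite -{1}[p]psubst_id; apply: psubst_eqmod. Qed.

(* The linear forms in [U] generate a prime ideal: it is the kernel of the
   substitution by a projection with kernel [U]. *)
Lemma linear_nzd0 : linear_nzd k m 0.
Proof.
move=> K n U w _ _ wU h.
pose V := <<U>>%MS; pose T := proj_mx (V^C)%MS V.
have dx : (V^C :&: V = 0)%MS by rewrite capmxC capmx_compl.
have TU v : (v <= U)%MS -> v *m T = 0.
  by move=> vU; apply: proj_mx_0 => //; rewrite genmxE.
have UT v : (v - v *m T <= U)%MS.
  rewrite -(genmxE U); apply: proj_mx_compl_sub.
  by apply: submx_full; rewrite addsmxC addsmx_compl_full.
have red p : in_ideal (bclin_gens K 0 U) (p - lsubst T p).
  apply: lsubst_eqmod => i; apply: in_ideal_gen; right.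
  exists (delta_mx 0 i - delta_mx 0 i *m T); first exact: UT.
  by rewrite linformB linform_delta -rowE.
have kill p : in_ideal (bclin_gens K 0 U) p -> lsubst T p = 0.
  move=> hp; have : in_ideal (fun q : {mpoly k[m]} => q = 0) (lsubst T p).
    apply: in_ideal_morph hp => g [[z [_ nz sz _]]|[v vU ->]].
      (* With bound [0] a nonzero relation has no room for its support, so there are no broken
         circuits. *)
      case/negP: nz; rewrite -vsupp_eq0; apply/eqP/setP => i; rewrite in_set0.
      by apply/negP => /sz.
    by apply: in_ideal_gen; rewrite /= lsubst_linform TU // linform0.
  case=> r [hr ->]; rewrite big_seq_cond big1 // => q; rewrite andbT => /hr ->.
  by rewrite mulr0.
move/kill; rewrite rmorphM /= lsubst_linform => /eqP; rewrite mulf_eq0 => /orP[/eqP|/eqP h0].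
  by move/linform_eq0 => wT; move: (UT w) wU; rewrite wT subr0 => ->.
by have := red h; rewrite h0 subr0.
Qed.

(** Allows for exceptional generators: [L] will say that the ideal contains [1]. *)
Lemma in_ideal_or (G H : {mpoly k[m]} -> Prop) (L : Prop) p :
  (forall g, G g -> H g \/ L) -> in_ideal G p -> in_ideal H p \/ L.
Proof.
move=> GH [r [hr ->]] {p}; elim: r hr => [|[q g] r IH] hr.
  by left; rewrite big_nil; apply: in_ideal0.
case: (GH _ (hr (q, g) (mem_head _ _))) => /= [Hg|]; last by right.
case: IH => [x xr| IH |]; [by apply: hr; rewrite inE xr orbT| |by right].
by left; rewrite big_cons; apply: in_idealD => //; apply/in_idealMl/in_ideal_gen.
Qed.

(* The forms are orthogonal to [K] but not to the contracted relations: the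
   change of coordinates [T] sends a form [v] with coefficient [1] at [e] to
   [x_e], which repairs this without affecting the other variables. *)
Lemma linear_nzd_con t e K n (U : 'M[k]_(n, m)) w : val e = t -> linear_nzd k m t ->
  orth K U -> orth K w -> ~~ (w <= U)%MS ->
  forall h, in_ideal (bclin_gens (contract_rel K e) t U) (linform w * h) -> in_ideal (bclin_gens (contract_rel K e) t U) h.
Proof.
move=> et Pt oU ow wU h hh; pose V := (U + w)%MS.
have oV : orth K V by move=> z Kz; rewrite addsmx_sub oU ?ow.
have [/eqP V0|] := boolP (V *m (dlt e)^T == 0).
  have oV' : orth (contract_rel K e) V.
    move=> _ [z Kz ->]; apply/sub_kermxP; rewrite /drop_coord linearB linearZ /= mulmxBr.
    by rewrite (sub_kermxP (oV z Kz)) -scalemxAr V0 scaler0 subr0.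
  apply: Pt hh => //; apply: orth_sub oV' => //; [exact: addsmxSl|exact: addsmxSr].
case/matrix0Pn=> i [j]; rewrite {j}ord1 => Vi.
pose v := ((V *m (dlt e)^T) i 0)^-1 *: row i V.
have vV : (v <= V)%MS by apply/scalemx_sub/row_sub.
have ve : v *m (dlt e)^T = 1%:M.
  rewrite -scalemxAl -row_mul; apply/matrixP => a b.
  by rewrite !ord1 mxE [row _ _ _ _]mxE mulVf // mxE eqxx.
(* Only row [e] differs from the identity: it is twice the unit vector minus [v]. As [v] has
   coefficient [1] at [e], [v *m T] is the unit vector; the inverse [S] has [v] as its row [e]. *)
pose T : 'M[k]_m := 1%:M + (dlt e)^T *m (dlt e - v).
pose S : 'M[k]_m := 1%:M + (dlt e)^T *m (v - dlt e).
have dd : dlt e *m (dlt e)^T = 1%:M.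
  by apply/matrixP => a b; rewrite -rowE !ord1 !mxE !eqxx.
have TS : T *m S = 1%:M.
  have xD : (dlt e - v) *m (dlt e)^T = 0 by rewrite mulmxBl dd ve subrr.
  rewrite /T /S mulmxDl mul1mx mulmxDr mulmx1 mulmxA -[_ *m _ *m (dlt e)^T]mulmxA.
  by rewrite xD mulmx0 mul0mx addr0 -addrA -mulmxDr -[v - _]opprB addNr mulmx0 addr0.
(* Row [e] of [T] recovers the dropped coordinate because [v] is orthogonal to [z]. Hence forms
   orthogonal to [z] become, after [T], orthogonal to the contracted [z]. *)
have Tz z : K z -> T *m (drop_coord e z)^T = z^T.
  move=> Kz; have vz : v *m z^T = 0 by apply/sub_kermxP/(submx_trans vV)/oV.
  have ez : dlt e *m z^T = (z 0 e)%:M.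
    by apply/matrixP => a b; rewrite -rowE !ord1 !mxE.
  rewrite /drop_coord linearB linearZ /= /T mulmxDl mul1mx -mulmxA mulmxBr mulmxBl vz subr0 ez.
  rewrite -scalemxAr mulmxBl dd ve subrr scaler0 subr0 mul_mx_scalar.
  by rewrite subrK.
(* The monomial generators use indices below [t = val e] only, so a substitution changing just
   ['X_e] fixes them. *)
have fixmon A g (Tg : forall i, i != e -> row i A = delta_mx 0 i) :
    bc_gens (contract_rel K e) t g -> lsubst A g = g.
  move=> [z [_ _ sz ->]]; rewrite /sqfree rmorph_prod; apply: eq_bigr => j.
  rewrite inE => /andP[/sz jt _]; rewrite /= /lsubst psubstX Tg ?linform_delta //.
  by apply: contraTneq jt => ->; rewrite -et ltnn.
have rowA (x : 'rV_m) j : j != e -> row j (1%:M + (dlt e)^T *m x) = delta_mx 0 j.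
  move=> je; rewrite rowE mulmxDr mulmx1 mulmxA -rowE.
  have -> : row j (dlt e)^T = 0 by apply/matrixP => a b; rewrite !mxE (negbTE je) andbF.
  by rewrite mul0mx addr0.
have move_ideal A n1 (U1 : 'M_(n1, m)) p :
    (forall i, i != e -> row i A = delta_mx 0 i) ->
    in_ideal (bclin_gens (contract_rel K e) t U1) p -> in_ideal (bclin_gens (contract_rel K e) t (U1 *m A)) (lsubst A p).
  move=> hA; apply: in_ideal_morph => g [Jg|[x xU ->]]; apply: in_ideal_gen.
    by left; rewrite /= fixmon.
  by right; exists (x *m A); [exact: submxMr | rewrite /= lsubst_linform].
have := move_ideal T _ U _ (rowA _) hh; rewrite rmorphM /= lsubst_linform => {}hh.
have : in_ideal (bclin_gens (contract_rel K e) t (U *m T)) (lsubst T h).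
  apply: Pt hh.
  - move=> _ [z Kz ->]; apply/sub_kermxP; rewrite -mulmxA Tz //.
    exact/sub_kermxP/oU.
  - move=> _ [z Kz ->]; apply/sub_kermxP; rewrite -mulmxA Tz //.
    exact/sub_kermxP/ow.
  - apply: contra wU => /(submxMr S); by rewrite -!mulmxA TS !mulmx1.
move/(move_ideal S _ _ _ (rowA _)).
by rewrite lsubst_comp -mulmxA TS mulmx1 lsubst1.
Qed.

(** Deletion shows that [h] is a multiple ['X_e * h1] modulo the ideal; the colon by ['X_e] and
    regularity after contraction then place [h1] in the contracted ideal, and multiplying by ['X_e]
    returns to the original one. *)
Lemma linear_nzdS t e : val e = t -> linear_nzd k m t -> linear_nzd k m t.+1.
Proof.
move=> et Pt K n U w oU ow wU h hh.
(* If ['X_e] is itself among the forms, it is orthogonal to [K]: all relations vanish at [e] and the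
   bound [t] suffices. *)
have [eV|eV] := boolP (dlt e <= U + w)%MS.
  have JJ g : bc_gens K t.+1 g -> bc_gens K t g.
    move=> [z [Kz nz sz ->]]; exists z; split=> // i iz; apply: (ltn_last et); first exact: sz.
    apply: contraTneq iz => ->; rewrite inE negbK; apply/eqP.
    have /sub_kermxP : (dlt e <= kermx z^T)%MS.
      by apply: submx_trans eV _; rewrite addsmx_sub oU ?ow.
    by rewrite -rowE => /matrixP/(_ 0 0); rewrite !mxE.
  apply: (@bclin_gens_mono _ _ K t _ U) => // [g|]; first exact: bc_gens_le.
  by apply: (Pt K n U w) => //; apply: bclin_gens_mono hh.
(* A nonzero relation carried by [e] alone has an empty broken set, hence the generator [1]. Either
   it occurs and the ideal is everything, or such relations can be discarded. *)
pose K' z := K z /\ drop_coord e z != 0.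
have KK' z : K' z -> K z by case.
have nl : noloop K' e by move=> z [_ /eqP].
have : in_ideal (bclin_gens K' t.+1 U) (linform w * h) \/ in_ideal (bclin_gens K t.+1 U) 1.
  apply: in_ideal_or hh => g [[z [Kz nz sz ->]]|Lg]; last by left; right.
  have [z0|z0] := eqVneq (drop_coord e z) 0; last by left; left; exists z; split.
  right; apply: in_ideal_gen; left; exists z; split=> //.
  have only i : i \in vsupp z -> i = e.
    move=> iz; apply/eqP; apply: contraT => ie.
    by have := in_set0 i; rewrite -(eqP (etrans (vsupp_eq0 _) (introT eqP z0))) vsupp_drop in_setD1 ie iz.
  rewrite (_ : broken _ = set0) ?/sqfree ?big_set0 //.
  apply/setP => i; rewrite in_set0 inE; apply/negP => /andP[/only-> /exists_inP[y /only->]].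
  by rewrite ltnn.
case=> [{}hh|h1]; last by rewrite -[h]mulr1; apply: in_idealMl.
have oU' : orth K' U by apply: orth_sub oU.
have ow' : orth K' w by apply: orth_sub ow.
apply: (@bclin_gens_mono _ _ K' t.+1 _ U) => //; first by move=> g; apply: bc_gens_sub.
have [h1 hh1] := linear_nzd_vanish et Pt oU' ow' wU eV (bclin_gens_kill et nl hh).
have {}hh1 : in_ideal (bclin_gens K' t.+1 U) (h - 'X_e * h1).
  by apply: bclin_gens_mono hh1 => // g; apply: bc_gens_le.
apply: (in_ideal_eqmod hh1); apply: in_ideal_bclin_gensS => //.
apply: (linear_nzd_con et Pt oU' ow' wU); apply: (colon_last_variable et Pt nl) => //.
  by apply: contra eV => /submx_trans; apply; apply: addsmxSl.
have -> : 'X_e * (linform w * h1) = linform w * h - linform w * (h - 'X_e * h1) by ring.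
by apply: in_idealB => //; apply: in_idealMl.
Qed.

Lemma linear_nzd_all t : (t <= m)%N -> linear_nzd k m t.
Proof.
elim: t => [|t IH] tm; first exact: linear_nzd0.
by apply: (@linear_nzdS t (Ordinal tm)) => //; apply/IH/ltnW.
Qed.

End Regularity.


(** * Circuits, cocircuits and bases *)

Section SetSystems.
Variables (m : nat) (N : {set 'I_m} -> bool).
Implicit Types (A B C D S T : {set 'I_m}).

Lemma circuitP C : reflect (~~ N C /\ forall S, S \subset C -> ~~ N S -> S = C) (circuit N C).
Proof.
apply: (iffP andP) => -[NC h]; split=> //.
  move=> S SC NS; apply/eqP; apply: contraR NS => SnC.
  by apply: (implyP (forallP h S)); rewrite properEneq SnC.
apply/forallP => S; apply/implyP; rewrite properEneq => /andP[SnC SC].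
by apply: contraR SnC => NS; rewrite (h S).
Qed.

Lemma cocircuitP D : reflect (meets_all_bases N D /\
    forall S, S \subset D -> meets_all_bases N S -> S = D) (cocircuit N D).
Proof.
apply: (iffP andP) => -[NC h]; split=> //.
  move=> S SC NS; apply/eqP; apply: contraTT NS => SnC.
  by apply: (implyP (forallP h S)); rewrite properEneq SnC.
apply/forallP => S; apply/implyP; rewrite properEneq => /andP[SnC SC].
by apply: contra SnC => NS; rewrite (h S).
Qed.

Lemma mbasisP B : reflect (N B /\ forall T, B \subset T -> N T -> T = B) (mbasis N B).
Proof.
apply: (iffP andP) => -[NB h]; split=> //.
  by move=> T BT NT; apply/eqP/(implyP (forallP h T)); rewrite BT.
by apply/forallP => T; apply/implyP => /andP[BT NT]; rewrite (h T).
Qed.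

Lemma meets_basesP D : reflect (forall B, mbasis N B -> exists2 x, x \in D & x \in B)
  (meets_all_bases N D).
Proof.
apply: (iffP forallP) => h B.
  by move=> bB; have /set0Pn[x] := implyP (h B) bB; rewrite inE => /andP[]; exists x.
by apply/implyP => /h[x xD xB]; apply/set0Pn; exists x; rewrite inE xD.
Qed.

Lemma dep_circuit S : ~~ N S -> exists2 C, circuit N C & C \subset S.
Proof.
move=> NS; have [C /minsetP[NC h] CS] := @minset_exists _ (fun S => ~~ N S) S NS.
by exists C => //; apply/circuitP; split=> // T TC NT; apply: h.
Qed.

Lemma meets_cocircuit S : meets_all_bases N S -> exists2 D, cocircuit N D & D \subset S.
Proof.
move=> NS; have [C /minsetP[NC h] CS] := @minset_exists _ (meets_all_bases N) S NS.
by exists C => //; apply/cocircuitP; split=> // T TC NT; apply: h.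
Qed.

Lemma ext_basis S : N S -> exists2 B, mbasis N B & S \subset B.
Proof.
move=> NS; have [C /maxsetP[NC h] CS] := @maxset_exists _ N S NS.
by exists C => //; apply/mbasisP; split=> // T TC NT; apply: h.
Qed.

Hypothesis Nsub : forall S T, S \subset T -> N T -> N S.

Lemma fund_circuit B e : mbasis N B -> e \notin B ->
  exists C, [/\ circuit N C, C \subset e |: B & e \in C].
Proof.
move=> /mbasisP[NB Bmax] eB; have [|C cC CB] := @dep_circuit (e |: B).
  apply: contra eB => /(Bmax _ (subsetUr _ _)) <-; exact: setU11.
exists C; split=> //; apply: contraT => eC.
have /circuitP[/negP[]] := cC; apply: Nsub NB.
apply/subsetP => x xC; have := subsetP CB x xC; rewrite !inE => /orP[/eqP xe|//].
by rewrite -xe xC in eC.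
Qed.

Lemma fund_cocircuit B b : mbasis N B -> b \in B ->
  exists D, [/\ cocircuit N D, D \subset b |: ~: B & b \in D].
Proof.
move=> bB bb; have [NB Bmax] := mbasisP _ bB.
have [|D cD DB] := @meets_cocircuit (b |: ~: B).
  apply/meets_basesP => A /mbasisP[NA Amax].
  have [AB|/subsetPn[x xA xB]] := boolP (A \subset B); last first.
    by exists x => //; rewrite !inE xB orbT.
  by rewrite -(Amax B AB NB); exists b => //; apply: setU11.
exists D; split=> //; have /cocircuitP[/meets_basesP/(_ B bB)[x xD xB] _] := cD.
by have := subsetP DB x xD; rewrite !inE xB orbF => /eqP <-.
Qed.

End SetSystems.

(** * Consequences of orthogonal signings *)

Section Signing.
Variables (k : fieldType) (m : nat) (N : {set 'I_m} -> bool).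
Variables (sc sd : {set 'I_m} -> 'I_m -> k).
Implicit Types (A B C D S T : {set 'I_m}).
Hypothesis Nsub : forall S T, S \subset T -> N T -> N S.
Hypothesis scP : forall C, circuit N C -> forall e,
  (e \notin C -> sc C e = 0) /\ (e \in C -> sc C e = 1 \/ sc C e = -1).
Hypothesis sdP : forall D, cocircuit N D -> forall e,
  (e \notin D -> sd D e = 0) /\ (e \in D -> sd D e = 1 \/ sd D e = -1).
Hypothesis sorth : forall C D, circuit N C -> cocircuit N D ->
  \sum_(e : 'I_m) sc C e * sd D e = 0.

Lemma sc_neq0 C e : circuit N C -> (sc C e != 0) = (e \in C).
Proof.
move=> cC; have [h0 h1] := scP cC e; case: (boolP (e \in C)) => [/h1|/h0 ->].
  by case=> ->; rewrite ?oppr_eq0 oner_eq0.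
by rewrite eqxx.
Qed.

Lemma sd_neq0 D e : cocircuit N D -> (sd D e != 0) = (e \in D).
Proof.
move=> cD; have [h0 h1] := sdP cD e; case: (boolP (e \in D)) => [/h1|/h0 ->].
  by case=> ->; rewrite ?oppr_eq0 oner_eq0.
by rewrite eqxx.
Qed.

(** If [x] were the only common element, the orthogonality sum would reduce to one product of
    nonzero signs. *)
Lemma not_single C D x : circuit N C -> cocircuit N D -> x \in C -> x \in D ->
  exists y, [/\ y \in C, y \in D & y != x].
Proof.
move=> cC cD xC xD.
case: (pickP (fun y => [&& y \in C, y \in D & y != x])) => [y /and3P[]|no].
  by exists y.
have := sorth cC cD; rewrite (bigD1 x) //= big1 ?addr0 => [/eqP|y yx].
  by rewrite mulf_eq0 -[_ || _]negbK negb_or sc_neq0 // sd_neq0 // xC xD.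
have := no y; rewrite yx andbT => /negbT; rewrite negb_and => /orP[/(scP cC y).1|/(sdP cD y).1] ->.
  by rewrite mul0r.
by rewrite mulr0.
Qed.

Section Basis.
Variable B : {set 'I_m}.
Hypothesis bB : mbasis N B.

Lemma ciP e : e \notin B ->
  [/\ circuit N (ci N B e), ci N B e \subset e |: B & e \in ci N B e].
Proof.
move=> eB; rewrite /ci; case: pickP => [C /andP[/andP[]]|no] //=.
by have [C [h1 h2 h3]] := fund_circuit Nsub bB eB; have := no C; rewrite h1 h2 h3.
Qed.

Lemma cocP b : b \in B ->
  [/\ cocircuit N (coc N B b), coc N B b \subset b |: ~: B & b \in coc N B b].
Proof.
move=> bb; rewrite /coc; case: pickP => [C /andP[/andP[]]|no] //=.
by have [C [h1 h2 h3]] := fund_cocircuit bB bb; have := no C; rewrite h1 h2 h3.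
Qed.

(** [C] and [D] can only meet in [x] and [b], and they cannot meet in exactly one of them. *)
Lemma coc_ci b x C D : b \in B -> x \notin B ->
  circuit N C -> C \subset x |: B -> x \in C ->
  cocircuit N D -> D \subset b |: ~: B -> b \in D -> (x \in D) = (b \in C).
Proof.
move=> bb xB cC CB xC cD DB bD; apply/idP/idP => [xD|bC].
  have [y [yC yD yx]] := not_single cC cD xC xD.
  have := subsetP CB y yC; have := subsetP DB y yD; rewrite !inE (negbTE yx) /=.
  by move=> /orP[/eqP <-|/negP].
have [y [yC yD yb]] := not_single cC cD bC bD.
have := subsetP CB y yC; have := subsetP DB y yD; rewrite !inE (negbTE yb) /=.
by move=> /negbTE -> /orP[/eqP<-|].
Qed.

(** For [y] in [B], membership in any such circuit is decided by the fundamental cocircuit of [y],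
    which does not depend on the circuit. *)
Lemma ci_uniq x C : x \notin B -> circuit N C -> C \subset x |: B -> x \in C ->
  C = ci N B x.
Proof.
move=> xB cC CB xC; have [cC' CB' xC'] := ciP xB; apply/setP => y.
have [->|yx] := eqVneq y x; first by rewrite xC xC'.
have [yB|yB] := boolP (y \in B).
  have [h1 h2 h3] := cocP yB.
  by rewrite -(coc_ci yB xB cC CB xC h1 h2 h3) -(coc_ci yB xB cC' CB' xC' h1 h2 h3).
transitivity false; last symmetry; apply: contraNF yB.
  by move/(subsetP CB); rewrite !inE (negbTE yx).
by move/(subsetP CB'); rewrite !inE (negbTE yx).
Qed.

Lemma coc_uniq b D : b \in B -> cocircuit N D -> D \subset b |: ~: B -> b \in D ->
  D = coc N B b.
Proof.
move=> bb cD DB bD; have [cD' DB' bD'] := cocP bb; apply/setP => y.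
have [->|yb] := eqVneq y b; first by rewrite bD bD'.
have [yB|yB] := boolP (y \in B).
  transitivity false; last symmetry; apply: contraTF yB.
    by move/(subsetP DB); rewrite !inE (negbTE yb).
  by move/(subsetP DB'); rewrite !inE (negbTE yb).
have [h1 h2 h3] := ciP yB.
by rewrite (coc_ci bb yB h1 h2 h3 cD DB bD) (coc_ci bb yB h1 h2 h3 cD' DB' bD').
Qed.

Lemma mem_coc b x : b \in B -> x \notin B -> (x \in coc N B b) = (b \in ci N B x).
Proof.
by move=> bb xB; have [h1 h2 h3] := ciP xB; have [h4 h5 h6] := cocP bb; apply: coc_ci.
Qed.

Definition corth (v : 'I_m -> k) : Prop :=
  forall C, circuit N C -> \sum_e sc C e * v e = 0.

Lemma corth_vanish v : corth v -> (forall b, b \in B -> v b = 0) -> forall i, v i = 0.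
Proof.
move=> ov v0 i; have [/v0//|iB] := boolP (i \in B).
have [cC CB iC] := ciP iB; have /eqP := ov _ cC.
rewrite (bigD1 i) //= big1 ?addr0 => [|j ji].
  by rewrite mulf_eq0 -[sc _ _ == 0]negbK sc_neq0 // iC /= => /eqP.
have [/v0->|jB] := boolP (j \in B); first by rewrite mulr0.
rewrite ((scP cC j).1 _) ?mul0r //; apply: contra jB => /(subsetP CB).
by rewrite !inE (negbTE ji).
Qed.

(** Each fundamental cocircuit meets [B] only in its own element, so this combination agrees with
    [v] on [B]. The difference is still orthogonal to the circuits, and fundamental circuits force
    it to vanish off [B] too. *)
Lemma corth_span v : corth v -> forall i,
  v i = \sum_(j in B) v j / sd (coc N B j) j * sd (coc N B j) i.
Proof.
move=> ov i; apply/eqP; rewrite -subr_eq0; apply/eqP.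
pose d x := v x - \sum_(j in B) v j / sd (coc N B j) j * sd (coc N B j) x.
rewrite -/(d i); apply: corth_vanish => [C cC|b bb].
  rewrite /d; under eq_bigr => e _ do rewrite mulrBr mulr_sumr.
  rewrite sumrB ov // sub0r exchange_big big1 ?oppr0 //= => j jB.
  under eq_bigr => e _ do rewrite mulrCA.
  by rewrite -mulr_sumr sorth ?mulr0 //; case: (cocP jB).
rewrite /d (bigD1 b) //= big1 => [|j /andP[jB jb]].
  have [cD DB bD] := cocP bb.
  by rewrite divfK ?addr0 ?subrr // sd_neq0.
have [cD DB jD] := cocP jB; rewrite ((sdP cD b).1 _) ?mulr0 //.
by apply: contraTN bb => /(subsetP DB); rewrite !inE eq_sym (negbTE jb).
Qed.

End Basis.

(* A linear relation orthogonal to all cocircuits cannot be supported on an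
   independent set: pair it with a fundamental cocircuit. *)
Lemma relation_dep (z : 'rV[k]_m) :
  (forall D, cocircuit N D -> \sum_e z 0 e * sd D e = 0) -> z != 0 -> ~~ N (vsupp z).
Proof.
move=> oz; rewrite -vsupp_eq0 => /set0Pn[b bz]; apply/negP => /ext_basis[B bB zB].
have [D [cD DB bD]] := fund_cocircuit bB (subsetP zB b bz).
have := oz D cD; rewrite (bigD1 b) //= big1 ?addr0 => [/eqP|j jb].
  by rewrite mulf_eq0 -[_ || _]negbK negb_or sd_neq0 // bD andbT; rewrite inE in bz; rewrite bz.
have [jz|] := boolP (j \in vsupp z); last by rewrite inE negbK => /eqP->; rewrite mul0r.
rewrite ((sdP cD j).1 _) ?mulr0 //; apply/negP => /(subsetP DB).
by rewrite !inE (negbTE jb) (subsetP zB).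
Qed.

End Signing.

(** * Membership of linear forms in the defining ideal *)

Section Theta.
Variables (k : fieldType) (m : nat) (N : {set 'I_m} -> bool) (s : nat).
Variables (sd : {set 'I_m} -> 'I_m -> k) (a : 'I_m -> 'I_m -> k).
Hypothesis sdP : forall D, cocircuit N D -> forall e,
  (e \notin D -> sd D e = 0) /\ (e \in D -> sd D e = 1 \/ sd D e = -1).
Hypothesis aP : forall j, j \in Bst m s -> forall i, a j i = sd (coc N (Bst m s) j) i.
Hypothesis bB : mbasis N (Bst m s).

Lemma thetaE j : j \in Bst m s -> theta N s a j = linform (\row_i sd (coc N (Bst m s) j) i).
Proof.
move=> jB; have [cD _ _] := cocP bB jB; rewrite /theta /linform [RHS](bigID (mem (coc N (Bst m s) j))) /=.
rewrite [X in _ + X]big1 => [|i iD]; last by rewrite mxE (sdP cD i).1 // scale0r.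
by rewrite addr0; apply: eq_bigr => i _; rewrite mxE aP.
Qed.

Variable sc : {set 'I_m} -> 'I_m -> k.
Hypothesis Nsub : forall S T : {set 'I_m}, S \subset T -> N T -> N S.
Hypothesis scP : forall C, circuit N C -> forall e,
  (e \notin C -> sc C e = 0) /\ (e \in C -> sc C e = 1 \/ sc C e = -1).
Hypothesis sorth : forall C D, circuit N C -> cocircuit N D ->
  \sum_(e : 'I_m) sc C e * sd D e = 0.

(** Frees the later arguments from fundamental cocircuits: a form belongs to the ideal as soon as it
    is orthogonal to the signed circuits, wherever it comes from. *)
Lemma linform_corth (v : 'rV[k]_m) : corth N sc (v 0) -> in_ideal (gens N s a) (linform v).
Proof.
move=> ov; have -> : v = \sum_(j in Bst m s) (v 0 j / sd (coc N (Bst m s) j) j) *: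
    \row_i sd (coc N (Bst m s) j) i.
  apply/rowP => i; rewrite (corth_span Nsub scP sdP sorth bB ov) summxE.
  by apply: eq_bigr => j _; rewrite !mxE.
rewrite linform_sum; apply: in_ideal_sum => j jB; rewrite linformZ -thetaE //.
by apply/in_idealZ/in_ideal_gen; right; exists j.
Qed.

End Theta.


(** * Matroid bases, and the monomials attached to circuits *)

Section Bases.
Variables (m : nat) (N : {set 'I_m} -> bool).
Hypothesis mN : is_matroid N.

Lemma indep_sub (S T : {set 'I_m}) : S \subset T -> N T -> N S.
Proof. by case: mN => _ h _; apply: h. Qed.

Lemma card_indep (A T : {set 'I_m}) : mbasis N A -> N T -> (#|T| <= #|A|)%N.
Proof.
move=> /mbasisP[NA Amax] NT; rewrite leqNgt; apply/negP => lt.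
case: mN => _ _ /(_ A T NA NT lt) [x]; rewrite inE => /andP[xA _] /(Amax _ (subsetUr _ _)) E.
by rewrite -E setU11 in xA.
Qed.

Lemma ext_within (S A : {set 'I_m}) : N S -> mbasis N A ->
  exists A', [/\ mbasis N A', S \subset A' & A' \subset S :|: A].
Proof.
move=> NS bA; have [NA _] := mbasisP _ _ bA.
have [|T /maxsetP[/andP[NT TSA] Tmax] ST] :=
  @maxset_exists _ (fun T => N T && (T \subset S :|: A)) S _.
  by rewrite NS subsetUl.
exists T; split=> //; apply/mbasisP; split=> // T' TT' NT'.
apply/esym/eqP; rewrite eqEcard TT' (leq_trans (card_indep bA NT')) // leqNgt.
apply/negP => lt; case: mN => _ _ /(_ T A NT NA lt) [x]; rewrite inE => /andP[xT xA] Nx.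
have E : x |: T = T.
  apply: Tmax; last exact: subsetUr.
  by rewrite Nx subUset TSA sub1set inE xA orbT.
by rewrite -E setU11 in xT.
Qed.

End Bases.

Lemma ddP (m : nat) (N : {set 'I_m} -> bool) s j : mbasis N (Bst m s) -> j \in Bst m s ->
  dd N s j \in coc N (Bst m s) j /\
  forall i, i \in coc N (Bst m s) j -> (dd N s j <= i)%N.
Proof.
move=> bB jB; have [_ _ jD] := cocP bB jB; rewrite /dd.
rewrite ltnNge; move: (jB); rewrite inE => -> /=.
case: pickP => [i /andP[iD /forallP h]|no] /=.
  by split=> // i' /(implyP (h i')).
have [i iD imin] := arg_minnP (@nat_of_ord m) jD.
have := no i; rewrite /= (iD : i \in coc N (Bst m s) j) /= => /negbT/forallPn[i']; rewrite negb_imply.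
by case/andP=> /imin ->.
Qed.

Lemma dd_min (m : nat) (N : {set 'I_m} -> bool) s j d : mbasis N (Bst m s) ->
  j \in Bst m s -> d \in coc N (Bst m s) j ->
  (forall i, i \in coc N (Bst m s) j -> (d <= i)%N) -> dd N s j = d.
Proof.
move=> bB jB dD dmin; have [h1 h2] := ddP bB jB.
by apply/val_inj/eqP; rewrite /= eqn_leq h2 // dmin.
Qed.

Lemma dd_small (m : nat) (N : {set 'I_m} -> bool) s j : j \notin Bst m s -> dd N s j = j.
Proof. by rewrite inE -ltnNge /dd => ->. Qed.

Lemma mC_fund (m : nat) (N : {set 'I_m} -> bool) s
    i :
  (forall S T : {set 'I_m}, S \subset T -> N T -> N S) ->
  mbasis N (Bst m s) -> i \notin Bst m s ->
  mC N s (ci N (Bst m s) i) = (U_(i) *+ #|broken (ci N (Bst m s) i)|)%MM.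
Proof.
move=> Nsub bB iB; rewrite /mC; case: pickP => [i' /andP[i's /eqP E]|no].
  have i'B : i' \notin Bst m s by rewrite inE -ltnNge.
  have [_ _] := ciP Nsub bB i'B; rewrite -E; have [_ h _] := ciP Nsub bB iB.
  by move/(subsetP h); rewrite in_setU1 (negbTE i'B) orbF => /eqP->.
by have := no i; rewrite eqxx andbT ltnNge; move: iB; rewrite inE => ->.
Qed.

Lemma mC_nonfund (m : nat) (N : {set 'I_m} -> bool) s C :
  (forall i, i \notin Bst m s -> C <> ci N (Bst m s) i) ->
  mC N s C = (\sum_(j in broken C) U_(dd N s j))%MM.
Proof.
move=> h; rewrite /mC; case: pickP => [i /andP[i1 /eqP]|//].
by move/h; rewrite inE -ltnNge => /(_ i1).
Qed.

(** * Passing between ['I_n] and ['I_n.+1] *)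

Section Widen.
Variable n : nat.
Definition wide : 'I_n -> 'I_n.+1 := widen_ord (leqnSn n).
Definition wideset (S : {set 'I_n}) : {set 'I_n.+1} := wide @: S.
Definition narrow (T : {set 'I_n.+1}) : {set 'I_n} := wide @^-1: T.
Local Notation top := (@ord_max n).

Lemma wide_inj : injective wide.
Proof. by move=> i j /(congr1 val) /= /val_inj. Qed.

Lemma wide_top i : (wide i == top) = false.
Proof. by apply/eqP => /(congr1 val) /= E; have := ltn_ord i; rewrite E ltnn. Qed.

Lemma wideP (i : 'I_n.+1) : i != top -> exists j, i = wide j.
Proof.
move=> it; have lt : (i < n)%N.
  by rewrite ltn_neqAle -ltnS ltn_ord andbT; apply: it.
by exists (Ordinal lt); apply: val_inj.
Qed.

Lemma mem_wideset i (S : {set 'I_n}) : (wide i \in wideset S) = (i \in S).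
Proof. by rewrite /wideset mem_imset //; apply: wide_inj. Qed.

Lemma top_wideset S : (top \in wideset S) = false.
Proof. by apply/imsetP => -[i _ /eqP]; rewrite eq_sym wide_top. Qed.

Lemma mem_narrow i (T : {set 'I_n.+1}) : (i \in narrow T) = (wide i \in T).
Proof. by rewrite inE. Qed.

Lemma narrowW S : narrow (wideset S) = S.
Proof. by apply/setP => i; rewrite mem_narrow mem_wideset. Qed.

Lemma wideset_narrow T : wideset (narrow T) = T :\ top.
Proof.
apply/setP => i; rewrite !inE; have [->|/wideP[j ->]] := eqVneq i top; first by rewrite top_wideset.
by rewrite mem_wideset mem_narrow.
Qed.

Lemma wideset_narrow_id (T : {set 'I_n.+1}) : top \notin T -> wideset (narrow T) = T.
Proof. by move=> tT; rewrite wideset_narrow; apply/setDidPl; rewrite disjoint_sym disjoints1. Qed.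

Lemma wideset_inj : injective wideset. Proof. exact: can_inj narrowW. Qed.

Lemma wideset_sub (S T : {set 'I_n}) : (wideset S \subset wideset T) = (S \subset T).
Proof.
apply/subsetP/subsetP => h i; first by rewrite -(mem_wideset i S) -(mem_wideset i T); apply: h.
by case/imsetP=> j jS ->; rewrite mem_wideset h.
Qed.

Lemma wideset_subr (S : {set 'I_n}) (T : {set 'I_n.+1}) : (wideset S \subset T) = (S \subset narrow T).
Proof.
apply/subsetP/subsetP => h i; first by rewrite -(mem_wideset i S) mem_narrow; apply: h.
by case/imsetP=> j jS ->; rewrite -mem_narrow h.
Qed.

Lemma sub_wideset (T : {set 'I_n.+1}) (S : {set 'I_n}) : T \subset wideset S -> wideset (narrow T) = T /\ narrow T \subset S.
Proof.
move=> TS; have tT : top \notin T by apply: contraFN (top_wideset S); apply: (subsetP TS).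
by rewrite wideset_narrow_id // -wideset_sub wideset_narrow_id.
Qed.

Lemma le_top (S : {set 'I_n.+1}) i : i \in S -> (i <= top)%N.
Proof. by move=> _; rewrite -ltnS ltn_ord. Qed.

Lemma broken_wideset S : broken (wideset S) = wideset (broken S).
Proof.
apply/setP => i; have [->|/wideP[j ->]] := eqVneq i top; first by rewrite inE !top_wideset.
rewrite mem_wideset !inE mem_wideset; congr (_ && _).
apply/exists_inP/exists_inP => -[y yS lt]; last by exists (wide y); rewrite ?mem_wideset.
by case/imsetP: yS lt => x xS -> lt; exists x.
Qed.

Lemma broken_top (C : {set 'I_n.+1}) : top \in C -> narrow C != set0 -> broken C = top |: wideset (broken (narrow C)).
Proof.
move=> tC; case/set0Pn=> x; rewrite mem_narrow => xC.
rewrite -broken_wideset wideset_narrow -broken_max //; first exact: le_top.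
by apply/set0Pn; exists (wide x); rewrite !inE wide_top.
Qed.

Lemma card_wideset S : #|wideset S| = #|S|.
Proof. by rewrite card_imset //; apply: wide_inj. Qed.

Lemma mnmwidenMn (a : 'X_{1..n}) c : mnmwiden (a *+ c)%MM = (mnmwiden a *+ c)%MM.
Proof.
elim: c => [|c IH]; first by rewrite !mulm0n mnmwiden0.
by rewrite !mulmS mnmwidenD IH.
Qed.

Lemma mnmwiden_le (a b : 'X_{1..n}) : (mnmwiden a <= mnmwiden b)%MM = (a <= b)%MM.
Proof.
apply/mnm_lepP/mnm_lepP => h i; first by have := h (wide i); rewrite !mnmwiden_widen.
have [->|/wideP[j ->]] := eqVneq i top; first by rewrite !mnmwiden_ordmax.
by rewrite !mnmwiden_widen.
Qed.

End Widen.


Lemma inLP m (N : {set 'I_m} -> bool) s (mm : 'X_{1..m}) : reflect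
  ((forall i : 'I_m, i \in Bst m s -> mm i = 0%N) /\
   (forall C, circuit N C -> ~~ (mC N s C <= mm)%MM)) (inL N s mm).
Proof.
apply: (iffP andP) => -[h1 h2]; split.
- by move=> i; rewrite inE => /(implyP (forallP h1 i))/eqP.
- by move=> C; apply/implyP/(forallP h2).
- by apply/forallP => i; apply/implyP => iB; apply/eqP/h1; rewrite inE.
- by apply/forallP => C; apply/implyP/h2.
Qed.

Lemma msupp_sumX (k : fieldType) m (I : eqType) (s : seq I) (P : pred I) (c : I -> k)
    (F : I -> 'X_{1..m}) mm :
  mm \in msupp (\sum_(x <- s | P x) c x *: 'X_[F x]) ->
  exists x, [/\ x \in s, P x & mm = F x].
Proof.
elim: s => [|x s IH]; first by rewrite big_nil msupp0.
have IH' : mm \in msupp (\sum_(x <- s | P x) c x *: 'X_[F x]) ->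
    exists y, [/\ y \in x :: s, P y & mm = F y].
  by move=> /IH[y [ys Py ->]]; exists y; rewrite inE ys orbT.
rewrite big_cons; case: ifP => // Px /msuppD_le; rewrite mem_cat => /orP[|//].
rewrite mcoeff_msupp mcoeffZ mcoeffX; case: (F x =P mm) => [<- _|_]; last by rewrite mulr0 eqxx.
by exists x; rewrite mem_head.
Qed.

Lemma msupp_mwiden (k : fieldType) n (p : {mpoly k[n]}) mm : mm \in msupp (mwiden p) ->
  exists2 nu, nu \in msupp p & mm = mnmwiden nu.
Proof.
have -> : mwiden p = \sum_(nu <- msupp p) p@_nu *: 'X_[mnmwiden nu].
  rewrite {1}[p]mpolyE raddf_sum; apply: eq_bigr => nu _.
  by rewrite /= mwidenZ mwidenX.
by case/msupp_sumX=> nu [h _ ->]; exists nu.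
Qed.

(** * Deletion and contraction of [top] *)

Section Minors.
Variables (k : fieldType) (n r : nat) (M : {set 'I_n.+1} -> bool).
Hypotheses (mM : is_matroid M) (r0 : (0 < r)%N) (rn : (r <= n)%N).
Local Notation top := (@ord_max n).
Local Notation u := (@inord n (n - r)).
Local Notation B := (Bst n.+1 r).
Hypotheses (bB : mbasis M B) (cU : cocircuit M [set top; u]).
Local Notation N1 := (del_last M).
Local Notation N2 := (con_last M).
Local Notation B1 := (Bst n r).
Local Notation B2 := (Bst n r.-1).

Lemma ltu : (n - r < n)%N.
Proof. by rewrite ltn_subrL r0 (leq_trans r0 rn). Qed.
(** The partner of [top] in the smaller ground set. With indices from [0] it is the last element
    outside [B2], as [u] is for [B], but the first element of [B1]. *)
Definition u0 : 'I_n := Ordinal ltu.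

Lemma wide_u0 : wide u0 = u.
Proof. by apply: val_inj; rewrite /= inordK // ltnS leq_subr. Qed.

Lemma u_top : (u == top) = false.
Proof. by rewrite -wide_u0 wide_top. Qed.

Lemma in_B i : (wide i \in B) = (u0 < i)%N.
Proof. by rewrite inE subSn. Qed.
Lemma in_B1 i : (i \in B1) = (u0 <= i)%N.
Proof. by rewrite inE. Qed.
Lemma in_B2 i : (i \in B2) = (u0 < i)%N.
Proof. by rewrite inE -(subSn rn) -[in RHS](prednK r0) subSS. Qed.
Lemma top_B : top \in B.
Proof. by rewrite inE subSn //= ltu. Qed.

Lemma N1E S : N1 S = M (wideset S). Proof. by []. Qed.

Lemma N2P (S : {set 'I_n}) : reflect (exists2 A : {set 'I_n}, S \subset A & mbasis M (top |: wideset A)) (N2 S).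
Proof. by apply: (iffP existsP) => [[A /andP[]]|[A h1 h2]]; exists A => //; rewrite h1. Qed.

Lemma N1sub (S T : {set 'I_n}) : S \subset T -> N1 T -> N1 S.
Proof. by rewrite -wideset_sub !N1E; apply: indep_sub. Qed.

Lemma N2sub (S T : {set 'I_n}) : S \subset T -> N2 T -> N2 S.
Proof. by move=> ST /N2P[A TA bA]; apply/N2P; exists A => //; apply: subset_trans TA. Qed.

Lemma circuit1 S : circuit N1 S = circuit M (wideset S).
Proof.
apply/circuitP/circuitP => -[h1 h2]; split=> // T TS NT.
  by have [TE RT] := sub_wideset TS; rewrite -TE (h2 (narrow T)) // N1E TE.
by apply: wideset_inj; apply: h2; rewrite ?wideset_sub.
Qed.

(** Minimality of the cocircuit: [[set top]] alone does not meet every basis. This keeps the rank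
    unchanged under deletion. *)
Lemma basis_avoid : exists2 A : {set 'I_n.+1}, mbasis M A & top \notin A.
Proof.
have /cocircuitP[_ h] := cU; have nm : ~~ meets_all_bases M [set top].
  apply/negP => /h; rewrite sub1set set21 => /(_ isT) /setP/(_ u).
  by rewrite !inE eqxx orbT u_top.
case/forallPn: nm => A; rewrite negb_imply negbK => /andP[bA /eqP/setP/(_ top)].
by rewrite !inE eqxx /= => tA; exists A => //; rewrite tA.
Qed.

Lemma bases1 A : mbasis N1 A = mbasis M (wideset A).
Proof.
apply/idP/idP => [/mbasisP[NA Amax]|/mbasisP[NA Amax]]; last first.
  apply/mbasisP; split=> // T AT NT; apply: wideset_inj; apply: Amax => //.
  by rewrite wideset_sub.
have [A0 bA0 tA0] := basis_avoid; have [A' [bA' h1 h2]] := ext_within mM NA bA0.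
have tA' : top \notin A'.
  by apply/negP => /(subsetP h2); rewrite inE top_wideset (negbTE tA0).
have [NA' _] := mbasisP _ _ bA'.
by rewrite -(Amax (narrow A')) ?wideset_narrow_id // -?wideset_subr // N1E wideset_narrow_id.
Qed.

Lemma bases2 A : mbasis N2 A = mbasis M (top |: wideset A).
Proof.
apply/idP/idP => [/mbasisP[/N2P[A' h1 h2] Amax]|bA].
  by rewrite -(Amax A') //; apply/N2P; exists A'.
apply/mbasisP; split=> [|T AT /N2P[T' h1 h2]]; first by apply/N2P; exists A.
have E : top |: wideset T' = top |: wideset A.
  have [_ Amax] := mbasisP _ _ bA; apply: Amax; last by case/mbasisP: h2.
  by rewrite setUS // wideset_sub (subset_trans AT).
have {}E : T' = A.
  apply/setP => i; have /setP/(_ (wide i)) := E.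
  by rewrite !in_setU1 wide_top /= !mem_wideset.
by apply/eqP; rewrite eqEsubset AT -{1}E h1.
Qed.

Lemma wideset_B2 : top |: wideset B2 = B.
Proof.
apply/setP => i; have [->|/wideP[j ->]] := eqVneq i top; first by rewrite setU11 top_B.
by rewrite in_setU1 wide_top /= mem_wideset in_B2 in_B.
Qed.

Lemma bB2 : mbasis N2 B2.
Proof. by rewrite bases2 wideset_B2. Qed.

Lemma wideset_B1 : wideset B1 = u |: (B :\ top).
Proof.
apply/setP => i; have [->|/wideP[j ->]] := eqVneq i top.
  by rewrite top_wideset in_setU1 eq_sym u_top !inE eqxx.
rewrite mem_wideset in_B1 in_setU1 in_setD1 wide_top in_B -wide_u0 (inj_eq (@wide_inj n)) /=.
by rewrite leq_eqVlt eq_sym.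
Qed.

Lemma u_notin_B : u \notin B.
Proof. by rewrite -wide_u0 in_B ltnn. Qed.

Lemma bB1 : mbasis N1 B1.
Proof.
rewrite bases1; have [NB _] := mbasisP _ _ bB.
have NBt : M (B :\ top) by apply: indep_sub NB => //; apply: subD1set.
(* A basis extending [B :\ top] and avoiding [top] must meet the cocircuit, hence contains [u];
   counting leaves room for nothing else. *)
have [A0 bA0 tA0] := basis_avoid; have [A' [bA' h1 h2]] := ext_within mM NBt bA0.
have tA' : top \notin A'.
  by apply/negP => /(subsetP h2); rewrite !inE eqxx (negbTE tA0).
have uA' : u \in A'.
  have /cocircuitP[/meets_basesP/(_ A' bA')[x]] := cU.
  by rewrite !inE => /orP[/eqP->|/eqP->]; rewrite ?(negbTE tA').
have -> : wideset B1 = A'; last by [].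
rewrite wideset_B1; apply/eqP; rewrite eqEcard subUset sub1set uA' h1 /=.
rewrite cardsU1 in_setD1 (negbTE u_notin_B) andbF /= (_ : (1 + _ = #|B|)%N).
  by apply: (card_indep mM bB); case/mbasisP: bA'.
by rewrite (cardsD1 top B) top_B.
Qed.

Lemma circuit2_dep C : circuit M C -> ~~ N2 (narrow C).
Proof.
move=> /circuitP[NC _]; apply: contra NC => /N2P[A CA /mbasisP[NA _]].
apply: indep_sub NA => //; apply: subset_trans (_ : top |: wideset (narrow C) \subset _).
  by rewrite wideset_narrow -subDset.
by rewrite setUS // wideset_sub.
Qed.

Lemma circuit2_lift S : circuit N2 S -> exists2 C, circuit M C & narrow C = S.
Proof.
move=> /circuitP[NS Smin].
have [|C cC CS] := @dep_circuit _ M (top |: wideset S).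
  apply: contra NS => /ext_basis[A bA SA]; apply/N2P; exists (narrow A).
    by rewrite -wideset_subr; apply: subset_trans SA; apply: subsetUr.
  by rewrite wideset_narrow setD1K // (subsetP SA) // setU11.
exists C => //; apply: Smin; last exact: circuit2_dep.
by rewrite -wideset_sub wideset_narrow subDset.
Qed.

Lemma cocircuit2 D : cocircuit N2 D -> cocircuit M (wideset D).
Proof.
move=> /cocircuitP[/meets_basesP mD Dmin]; apply/cocircuitP; split.
  apply/meets_basesP => A bA.
  have Nt : M [set top].
    by case/mbasisP: bB => NB _; apply: indep_sub NB => //; rewrite sub1set top_B.
  have [A' [bA' tA' A'A]] := ext_within mM Nt bA.
  have tA'' : top \in A' by rewrite -sub1set.
  have [|x xD xA] := mD (narrow A'); first by rewrite bases2 wideset_narrow setD1K.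
  exists (wide x); first by rewrite mem_wideset.
  by rewrite mem_narrow in xA; have := subsetP A'A _ xA; rewrite !inE wide_top.
move=> S SD /meets_basesP mS; have [SE RS] := sub_wideset SD; rewrite -SE (Dmin (narrow S)) //.
apply/meets_basesP => A; rewrite bases2 => /mS[x xS]; have := subsetP SD x xS.
by case/imsetP=> y yD E; rewrite E in_setU1 wide_top mem_wideset => yA; exists y; rewrite // mem_narrow -E.
Qed.

Lemma cocircuit1_lift D : cocircuit N1 D -> exists2 D', cocircuit M D' & narrow D' = D.
Proof.
move=> /cocircuitP[/meets_basesP mD Dmin].
have [|D' cD' D'D] := @meets_cocircuit _ M (top |: wideset D).
  apply/meets_basesP => A bA; have [tA|tA] := boolP (top \in A).
    by exists top => //; apply: setU11.
  have [|x xD xA] := mD (narrow A); first by rewrite bases1 wideset_narrow_id.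
  by exists (wide x); [rewrite in_setU1 mem_wideset xD orbT | rewrite -mem_narrow].
exists D' => //; apply: Dmin; first by rewrite -wideset_sub wideset_narrow subDset.
apply/meets_basesP => A; rewrite bases1 => bA.
have /cocircuitP[/meets_basesP/(_ _ bA)[x xD xA] _] := cD'.
by case/imsetP: xA xD => y yA -> yD; exists y; rewrite // mem_narrow.
Qed.

Variables (sc sd : {set 'I_n.+1} -> 'I_n.+1 -> k).
Hypothesis scP : forall C, circuit M C -> forall e,
  (e \notin C -> sc C e = 0) /\ (e \in C -> sc C e = 1 \/ sc C e = -1).
Hypothesis sdP : forall D, cocircuit M D -> forall e,
  (e \notin D -> sd D e = 0) /\ (e \in D -> sd D e = 1 \/ sd D e = -1).
Hypothesis sorth : forall C D, circuit M C -> cocircuit M D ->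
  \sum_(e : 'I_n.+1) sc C e * sd D e = 0.

Let Msub := indep_sub mM.

Lemma mem_top_circuit (C : {set 'I_n.+1}) : circuit M C -> (top \in C) = (u \in C).
Proof.
move=> cC; apply/idP/idP => xC.
  have [y [yC]] := not_single scP sdP sorth cC cU xC (set21 _ _).
  by rewrite !inE => /orP[/eqP->|/eqP<-]; rewrite ?eqxx.
have [y [yC]] := not_single scP sdP sorth cC cU xC (set22 _ _).
by rewrite !inE => /orP[/eqP<-|/eqP->]; rewrite ?eqxx.
Qed.

Lemma narrow_circuit_inj C C' : circuit M C -> circuit M C' -> narrow C = narrow C' -> C = C'.
Proof.
move=> cC cC' E; apply/setP => i; have [->|/wideP[j ->]] := eqVneq i top.
  by rewrite !mem_top_circuit // -wide_u0 -!mem_narrow E.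
by rewrite -!mem_narrow E.
Qed.

(** The trace contains a circuit of the contraction, lifted to [C']. As [top] follows [u] in both
    circuits, inclusion of traces gives [C' \subset C], and minimality concludes. *)
Lemma circuit2_narrow C : circuit M C -> circuit N2 (narrow C).
Proof.
move=> cC; have [S cS SC] := dep_circuit (circuit2_dep cC).
have [C' cC' E] := circuit2_lift cS.
suff C'C : C' \subset C.
  have [_ Cmin] := circuitP _ _ cC; have [NC' _] := circuitP _ _ cC'.
  by rewrite -(Cmin C' C'C NC') E.
apply/subsetP => i; have [->|/wideP[j ->]] := eqVneq i top.
  by rewrite !mem_top_circuit // -wide_u0 -!mem_narrow E; apply: (subsetP SC).
by rewrite -!mem_narrow E; apply: (subsetP SC).
Qed.

Lemma circuit_wideset (C : {set 'I_n.+1}) : circuit M C -> top \notin C -> circuit N1 (narrow C).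
Proof. by move=> cC tC; rewrite circuit1 wideset_narrow_id. Qed.

(** The minors inherit their signings from [M]. Circuits of the deletion and cocircuits of the
    contraction are those of [M] avoiding [top], which makes the term at [top] vanish in the
    orthogonality sums; the other two kinds are traces and need a lift. *)
Definition sc1 C i := sc (wideset C) (wide i).
Definition lift1 D := odflt set0 [pick D' | cocircuit M D' && (narrow D' == D)].
Definition sd1 D i := sd (lift1 D) (wide i).
Definition lift2 C := odflt set0 [pick C' | circuit M C' && (narrow C' == C)].
Definition sc2 C i := sc (lift2 C) (wide i).
Definition sd2 D i := sd (wideset D) (wide i).

Lemma lift1P D : cocircuit N1 D -> cocircuit M (lift1 D) /\ narrow (lift1 D) = D.
Proof.
move=> /cocircuit1_lift[D' cD' E]; rewrite /lift1; case: pickP => [D'' /andP[? /eqP]|/(_ D')] //.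
by rewrite cD' E eqxx.
Qed.

Lemma lift2P C : circuit N2 C -> circuit M (lift2 C) /\ narrow (lift2 C) = C.
Proof.
move=> /circuit2_lift[D' cD' E]; rewrite /lift2; case: pickP => [D'' /andP[? /eqP]|/(_ D')] //.
by rewrite cD' E eqxx.
Qed.

Lemma sum_wide (F : 'I_n.+1 -> k) : \sum_e F e = \sum_i F (wide i) + F top.
Proof. by rewrite big_ord_recr. Qed.

Lemma sc1P C : circuit N1 C -> forall e,
  (e \notin C -> sc1 C e = 0) /\ (e \in C -> sc1 C e = 1 \/ sc1 C e = -1).
Proof. by rewrite circuit1 => cC e; rewrite -mem_wideset; apply: scP. Qed.

Lemma sd1P D : cocircuit N1 D -> forall e,
  (e \notin D -> sd1 D e = 0) /\ (e \in D -> sd1 D e = 1 \/ sd1 D e = -1).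
Proof. by move=> /lift1P[cD E] e; rewrite -{1 3}E mem_narrow; apply: sdP. Qed.

Lemma sorth1 C D : circuit N1 C -> cocircuit N1 D -> \sum_e sc1 C e * sd1 D e = 0.
Proof.
rewrite circuit1 => cC /lift1P[cD _]; have := sorth cC cD.
by rewrite sum_wide (scP cC top).1 ?top_wideset // mul0r addr0.
Qed.

Lemma sc2P C : circuit N2 C -> forall e,
  (e \notin C -> sc2 C e = 0) /\ (e \in C -> sc2 C e = 1 \/ sc2 C e = -1).
Proof. by move=> /lift2P[cC E] e; rewrite -{1 3}E mem_narrow; apply: scP. Qed.

Lemma sd2P D : cocircuit N2 D -> forall e,
  (e \notin D -> sd2 D e = 0) /\ (e \in D -> sd2 D e = 1 \/ sd2 D e = -1).
Proof. by move=> /cocircuit2 cD e; rewrite -mem_wideset; apply: sdP. Qed.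

Lemma sorth2 C D : circuit N2 C -> cocircuit N2 D -> \sum_e sc2 C e * sd2 D e = 0.
Proof.
move=> /lift2P[cC _] /cocircuit2 cD; have := sorth cC cD.
by rewrite sum_wide (sdP cD top).1 ?top_wideset // mulr0 addr0.
Qed.

(** [u0] is the only element of [B1] outside [B], and no circuit avoiding [top] contains it. *)
Lemma ci1 (i : 'I_n) : (i < u0)%N -> wideset (ci N1 B1 i) = ci M B (wide i).
Proof.
move=> iu; have iB1 : i \notin B1 by rewrite in_B1 -ltnNge.
have iB : wide i \notin B by rewrite in_B -leqNgt ltnW.
have [cC CB iC] := ciP N1sub bB1 iB1.
apply: (ci_uniq Msub scP sdP sorth bB iB); rewrite -?circuit1 ?mem_wideset //.
apply/subsetP => _ /imsetP[j jC ->]; have := subsetP CB j jC.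
rewrite !in_setU1 (inj_eq (@wide_inj n)) in_B1 in_B leq_eqVlt => /orP[->//|].
case/orP=> [/eqP/val_inj E|->]; last by rewrite orbT.
have := mem_top_circuit (C := wideset (ci N1 B1 i)); rewrite -circuit1 cC => /(_ isT).
by rewrite top_wideset -wide_u0 mem_wideset E jC.
Qed.

Lemma ci2 (i : 'I_n) : (i <= u0)%N -> ci N2 B2 i = narrow (ci M B (wide i)).
Proof.
move=> iu; have iB2 : i \notin B2 by rewrite in_B2 -leqNgt.
have iB : wide i \notin B by rewrite in_B -leqNgt.
have [cC CB iC] := ciP Msub bB iB.
apply/esym/(ci_uniq N2sub sc2P sd2P sorth2 bB2 iB2); rewrite ?mem_narrow ?circuit2_narrow //.
apply/subsetP => j; rewrite mem_narrow => /(subsetP CB).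
by rewrite !in_setU1 (inj_eq (@wide_inj n)) in_B in_B2.
Qed.

Lemma coc2 (j : 'I_n) : (u0 < j)%N -> wideset (coc N2 B2 j) = coc M B (wide j).
Proof.
move=> ju; have jB2 : j \in B2 by rewrite in_B2.
have jB : wide j \in B by rewrite in_B.
have [cD DB jD] := cocP bB2 jB2.
apply: (coc_uniq Msub scP sdP sorth bB jB); rewrite ?mem_wideset ?cocircuit2 //.
apply/subsetP => _ /imsetP[i iD ->]; have := subsetP DB i iD.
by rewrite !in_setU1 (inj_eq (@wide_inj n)) !in_setC in_B in_B2.
Qed.

(** [ci1] transposed by circuit-cocircuit duality. The index [u0] stays out since it lies in [B1]
    while [u] is outside [B]. *)
Lemma coc1 (j x : 'I_n) : (u0 < j)%N -> (x < u0)%N ->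
  (x \in coc N1 B1 j) = (wide x \in coc M B (wide j)).
Proof.
move=> ju xu; rewrite (mem_coc N1sub sc1P sd1P sorth1 bB1) ?in_B1 ?(ltnW ju) -?ltnNge //.
rewrite (mem_coc Msub scP sdP sorth bB) ?in_B // -?leqNgt 1?ltnW //.
by rewrite -ci1 // mem_wideset.
Qed.

Lemma coc_top : coc M B top = [set top; u].
Proof.
apply/esym/(coc_uniq Msub scP sdP sorth bB top_B cU); rewrite ?set21 //.
by apply/subsetP => i; rewrite !inE => /orP[->//|/eqP->]; have := u_notin_B; rewrite inE => ->; rewrite orbT.
Qed.

Lemma dd_top : dd M r top = u.
Proof.
apply: dd_min; rewrite ?top_B // coc_top ?set22 //.
move=> i; rewrite !inE => /orP[/eqP->|/eqP->//].
by rewrite -wide_u0 /= leq_subr.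
Qed.

Lemma dd2 j : wide (dd N2 r.-1 j) = dd M r (wide j).
Proof.
have [ju|ju] := ltnP u0 j; last first.
  by rewrite !dd_small // ?in_B2 ?in_B -leqNgt.
apply/esym/dd_min; rewrite ?in_B // -coc2 //; have [h1 h2] := ddP bB2 (etrans (in_B2 j) ju).
  by rewrite mem_wideset.
by move=> _ /imsetP[i iD ->]; apply: h2.
Qed.

Lemma u0_circuit1 (C : {set 'I_n}) : circuit N1 C -> u0 \notin C.
Proof. by rewrite circuit1 => /mem_top_circuit; rewrite top_wideset -wide_u0 mem_wideset => <-. Qed.

(** The two cocircuits are only comparable below [u0], so their minimum must be shown to lie there.
    The circuit through [j] provides this: it meets the cocircuit of [j] in a second element, which
    is outside [B1]. *)
Lemma dd1 (C : {set 'I_n}) j : circuit N1 C -> j \in C ->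
  wide (dd N1 r j) = dd M r (wide j) /\ (dd N1 r j < u0)%N.
Proof.
move=> cC jC; have [ju|] := ltnP j u0.
  rewrite (@dd_small _ N1) ?in_B1 -?ltnNge // (@dd_small _ M) //.
  by rewrite in_B -leqNgt ltnW.
rewrite leq_eqVlt => /orP[/eqP/val_inj E|ju].
  by have := u0_circuit1 cC; rewrite E jC.
have jB1 : j \in B1 by rewrite in_B1 ltnW.
have [cD DB jD] := cocP bB1 jB1; have [h1 h2] := ddP bB1 jB1.
have [y [yC yD yj]] := not_single sc1P sd1P sorth1 cC cD jC jD.
have yu : (y < u0)%N.
  by have := subsetP DB y yD; rewrite in_setU1 (negbTE yj) in_setC in_B1 -ltnNge.
have du : (dd N1 r j < u0)%N by apply: leq_ltn_trans yu; apply: h2.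
split=> //; apply/esym/dd_min; rewrite ?in_B // -?coc1 //.
move=> i; have [->|/wideP[x ->]] := eqVneq i top; first by move=> _; rewrite /= ltnW.
have [xu|xu _] := ltnP x u0; first by rewrite -coc1 //; apply: h2.
by apply: ltnW; apply: leq_trans xu.
Qed.


Lemma notin_B_wide i : i \notin B -> exists2 j : 'I_n, i = wide j & (j <= u0)%N.
Proof.
have [->|/wideP[j ->]] := eqVneq i top; first by rewrite top_B.
by rewrite in_B -leqNgt; exists j.
Qed.

Lemma mC1 C : circuit N1 C -> mC M r (wideset C) = mnmwiden (mC N1 r C).
Proof.
move=> cC; have [i /andP[iB /eqP E]|no] := pickP (fun i => (i \notin B1) && (C == ci N1 B1 i)).
  have iu : (i < u0)%N by rewrite in_B1 -ltnNge in iB.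
  rewrite E (mC_fund N1sub bB1 iB) ci1 // (mC_fund Msub bB) ?in_B -?leqNgt 1?ltnW //.
  by rewrite -ci1 // broken_wideset card_wideset mnmwidenMn mnmwiden1.
rewrite !mC_nonfund => [|i iB E|i iB E].
- rewrite mnmwiden_sum broken_wideset big_imset /=; last by move=> x y _ _; apply: wide_inj.
  apply: eq_bigr => j; rewrite inE => /andP[jC _].
  by rewrite mnmwiden1; have [<- _] := dd1 cC jC.
- by have := no i; rewrite iB E eqxx.
- have [j ij ju] := notin_B_wide iB; move: ju; rewrite leq_eqVlt => /orP[/eqP/val_inj ju|ju].
    have [_ _] := ciP Msub bB iB; rewrite -E ij ju mem_wideset => uC.
    by have := u0_circuit1 cC; rewrite uC.
  by have := no j; rewrite in_B1 -ltnNge ju /= => /eqP[]; apply: wideset_inj; rewrite ci1 // -ij.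
Qed.

Lemma mC1_u0 C : circuit N1 C -> mC N1 r C u0 = 0%N.
Proof.
move=> cC; have [i /andP[iB /eqP E]|no] := pickP (fun i => (i \notin B1) && (C == ci N1 B1 i)).
  rewrite E (mC_fund N1sub bB1 iB) mulmnE mnm1E; case: eqP => // iu.
  by move: iB; rewrite iu in_B1 leqnn.
rewrite mC_nonfund => [|i iB E]; last by have := no i; rewrite iB E eqxx.
rewrite mnm_sumE big1 // => j; rewrite inE => /andP[jC _]; have [_] := dd1 cC jC.
by rewrite mnm1E; case: eqP => // ->; rewrite ltnn.
Qed.

(** If [top] is in [C], so is the smaller [u], hence [top] lies in the broken set and contributes
    its [dd], which is [u]. A fundamental circuit through [top] must be that of [u], so there the
    power of [x_u] just rises by one. *)
Lemma mC2 C : circuit M C ->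
  mC M r C = (mnmwiden (mC N2 r.-1 (narrow C)) + U_(u) *+ (top \in C))%MM.
Proof.
move=> cC.
have bC : broken C = if top \in C then top |: wideset (broken (narrow C)) else wideset (broken (narrow C)).
  case: (boolP (top \in C)) => tC; last by rewrite -broken_wideset wideset_narrow_id.
  apply: broken_top => //; apply/set0Pn; exists u0.
  by rewrite mem_narrow wide_u0 -mem_top_circuit.
have cardC : #|broken C| = (#|broken (narrow C)| + (top \in C))%N.
  by rewrite bC; case: (top \in C); rewrite ?cardsU1 ?top_wideset card_wideset ?addn0 // addnC.
have [i /andP[iB /eqP E]|no] := pickP (fun i => (i \notin B) && (C == ci M B i)).
  have [j ij ju] := notin_B_wide iB; have jB2 : j \notin B2 by rewrite in_B2 -leqNgt.
  have RC : narrow C = ci N2 B2 j by rewrite E ij ci2.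
  rewrite {1}E (mC_fund Msub bB iB) -E RC (mC_fund N2sub bB2 jB2) -RC cardC.
  rewrite mnmwidenMn mnmwiden1 -[widen_ord _ j]/(wide j) -ij.
  case tC: (top \in C); last by rewrite addn0 mulm0n addm0.
  rewrite addn1 mulmSr mulm1n; suff -> : i = u by [].
  have uC : u \in C by rewrite -mem_top_circuit.
  have [_ h _] := ciP Msub bB iB; have := subsetP h u; rewrite -E uC => /(_ isT).
  by rewrite in_setU1 (negbTE u_notin_B) orbF => /eqP.
rewrite !mC_nonfund => [|i iB E|i iB E].
- rewrite bC mnmwiden_sum; have sumW : (\sum_(j in wideset (broken (narrow C))) U_(dd M r j) =
    \sum_(j in broken (narrow C)) mnmwiden U_(dd N2 r.-1 j))%MM.
    rewrite big_imset /=; last by move=> x y _ _; apply: wide_inj.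
    by apply: eq_bigr => j _; rewrite mnmwiden1 -[widen_ord _ _]/(wide _) dd2.
  case: (top \in C); last by rewrite mulm0n addm0.
  by rewrite big_setU1 ?top_wideset //= dd_top addmC sumW mulm1n.
- have := no (wide i); rewrite in_B; rewrite in_B2 in iB; rewrite iB /= => /eqP[].
  have iu : (i <= u0)%N by rewrite leqNgt.
  have wB : wide i \notin B by rewrite in_B.
  have [cC' _ _] := ciP Msub bB wB.
  by apply: narrow_circuit_inj => //; rewrite E ci2.
- by have := no i; rewrite iB E eqxx.
Qed.

Lemma inL1_widen (nu : 'X_{1..n}) : inL N1 r nu -> inL M r (mnmwiden nu).
Proof.
move=> /inLP[nB nC]; apply/inLP; split=> [i|C cC].
  have [->|/wideP[j ->]] := eqVneq i top; first by rewrite mnmwiden_ordmax.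
  by rewrite in_B mnmwiden_widen => ju; apply: nB; rewrite in_B1 ltnW.
case: (boolP (top \in C)) => tC; last first.
  by rewrite -(wideset_narrow_id tC) mC1 ?circuit_wideset // mnmwiden_le nC // circuit_wideset.
(* A circuit through [top] requires a factor [x_u], which the monomial lacks because [u0] is in
   [B1]. *)
rewrite mC2 // tC; apply/mnm_lepP => /(_ u); rewrite mnmDE mulmnE mnm1E eqxx muln1.
by rewrite -wide_u0 !mnmwiden_widen nB ?in_B1 // addnC.
Qed.

Lemma inL1_restr (nu : 'X_{1..n}) : inL M r (mnmwiden nu) -> nu u0 = 0%N -> inL N1 r nu.
Proof.
move=> /inLP[nB nC] nu0; apply/inLP; split=> [i|C cC].
  rewrite in_B1 leq_eqVlt => /orP[/eqP/val_inj <-//|ui].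
  by rewrite -mnmwiden_widen nB // -/(wide i) in_B.
by rewrite -mnmwiden_le -mC1 // nC // -circuit1.
Qed.

Lemma inL2_widen (nu : 'X_{1..n}) : inL N2 r.-1 nu -> inL M r (mnmwiden nu + U_(u))%MM.
Proof.
move=> /inLP[nB nC]; apply/inLP; split=> [i|C cC].
  rewrite mnmDE mnm1E; have [->|/wideP[j ->]] := eqVneq i top.
    by rewrite mnmwiden_ordmax u_top.
  rewrite in_B mnmwiden_widen => ju; rewrite nB ?in_B2 // -wide_u0 (inj_eq (@wide_inj n)).
  by case: eqP ju => // ->; rewrite ltnn.
have := nC _ (circuit2_narrow cC); apply: contra; rewrite mC2 // -[X in _ -> is_true X]mnmwiden_le.
(* Through [top] the extra [x_u] cancels on both sides; otherwise [C] is a circuit of the deletion,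
   whose monomial is free of [x_u], so the added [x_u] cannot help divisibility. *)
case: (boolP (top \in C)) => tC.
  by move=> /mnm_lepP h; apply/mnm_lepP => i; have := h i; rewrite mulm1n !mnmDE leq_add2r.
have := mC2 cC; rewrite (negbTE tC) mulm0n addm0 -{1}(wideset_narrow_id tC) mC1 ?circuit_wideset // => <-.
move=> /mnm_lepP h; apply/mnm_lepP => i; have := h i; rewrite mnmDE mnm1E.
case: eqP => [<- _|_]; last by rewrite addn0.
by rewrite -wide_u0 mnmwiden_widen mC1_u0 // circuit_wideset.
Qed.

Lemma inL2_restr (nu : 'X_{1..n}) : inL M r (mnmwiden nu + U_(u))%MM -> inL N2 r.-1 nu.
Proof.
move=> /inLP[nB nC]; apply/inLP; split=> [i|C /lift2P[cC E]].
  rewrite in_B2 -in_B => /nB; rewrite mnmDE mnmwiden_widen => /eqP.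
  by rewrite addn_eq0 => /andP[/eqP].
have := nC _ cC; apply: contra; rewrite mC2 // E -[X in is_true X -> _]mnmwiden_le => /mnm_lepP h.
apply/mnm_lepP => i; rewrite !mnmDE mulmnE leq_add //.
by case: (top \in _); rewrite ?muln1 ?muln0.
Qed.


(** * The three ideals and the maps between them *)

Variable a : 'I_n.+1 -> 'I_n.+1 -> k.
Hypothesis aP : forall j, j \in B -> forall i, a j i = sd (coc M B j) i.
Let a1 j i := sd1 (coc N1 B1 j) i.
Let a2 j i := sd2 (coc N2 B2 j) i.
Local Notation IM := (gens M r a).
Local Notation I1 := (gens N1 r a1).
Local Notation I2 := (gens N2 r.-1 a2).

Lemma admissible1 : admissible N1 r a1.
Proof. by exists sc1, sd1; split=> //; [apply: sc1P | apply: sd1P | apply: sorth1]. Qed.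

Lemma admissible2 : admissible N2 r.-1 a2.
Proof. by exists sc2, sd2; split=> //; [apply: sc2P | apply: sd2P | apply: sorth2]. Qed.

Let linformM := linform_corth sdP aP bB Msub scP sorth.
Let lf1 := linform_corth sd1P (fun j _ i => erefl (a1 j i)) bB1 N1sub sc1P sorth1.
Let lf2 := linform_corth sd2P (fun j _ i => erefl (a2 j i)) bB2 N2sub sc2P sorth2.

Local Notation D0 := [set top; u].
(** Obtained by solving the form of the cocircuit [[set top; u]] for [x_top]. *)
Definition c0 : k := - sd D0 u / sd D0 top.

Lemma sd_top_neq0 : sd D0 top != 0.
Proof. by rewrite (sd_neq0 sdP) // set21. Qed.

Lemma c0_neq0 : c0 != 0.
Proof.
by rewrite mulf_neq0 ?invr_eq0 ?sd_top_neq0 // oppr_eq0 (sd_neq0 sdP) // set22.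
Qed.

Lemma Xtop_eqmod : in_ideal IM ('X_top - c0 *: 'X_u).
Proof.
have -> : 'X_top - c0 *: 'X_u = (sd D0 top)^-1 *: theta M r a top :> {mpoly k[n.+1]}.
  rewrite /theta coc_top big_setU1 ?inE 1?eq_sym ?u_top //= big_set1 !aP ?top_B // coc_top.
  rewrite scalerDr !scalerA mulVf ?sd_top_neq0 // scale1r /c0 mulNr scaleNr opprK.
  by rewrite mulrC.
by apply/in_idealZ/in_ideal_gen; right; exists top; rewrite top_B.
Qed.

(** Two values of [c] matter: [c0] inverts widening modulo the ideal of [M], and [0] kills [x_top],
    as deletion requires. *)
Definition hsub (c : k) (i : 'I_n.+1) : {mpoly k[n]} :=
  oapp (fun j : 'I_n => 'X_j) (c *: 'X_u0) (insub (i : nat)).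

Lemma hsub_wide c j : hsub c (wide j) = 'X_j.
Proof. by rewrite /hsub /= valK. Qed.

Lemma hsub_top c : hsub c top = c *: 'X_u0.
Proof. by rewrite /hsub insubN //= ltnn. Qed.

Local Notation phi c := (psubst (hsub c)).

Lemma mwiden_psubst (p : {mpoly k[n]}) : mwiden p = psubst (fun i => 'X_(wide i)) p.
Proof. by []. Qed.

Lemma phi_mwiden c p : phi c (mwiden p) = p.
Proof.
rewrite mwiden_psubst psubst_comp -[RHS]psubst_id; apply: psubst_ext => i.
by rewrite psubstX hsub_wide.
Qed.

Lemma mwidenXU i : mwiden 'X_i = 'X_(wide i) :> {mpoly k[n.+1]}.
Proof. by rewrite mwiden_psubst psubstX. Qed.

Lemma mwiden_phi f : in_ideal IM (f - mwiden (phi c0 f)).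
Proof.
rewrite mwiden_psubst psubst_comp -{1}[f]psubst_id; apply: psubst_eqmod => i.
have [->|/wideP[j ->]] := eqVneq i top; last by rewrite hsub_wide psubstX subrr; apply: in_ideal0.
by rewrite hsub_top psubstZ psubstX wide_u0; apply: Xtop_eqmod.
Qed.

Lemma mwiden_sqfree (S : {set 'I_n}) : mwiden (sqfree k S) = sqfree k (wideset S).
Proof.
rewrite /sqfree rmorph_prod /= big_imset /=; last by move=> x y _ _; apply: wide_inj.
by apply: eq_bigr => i _; rewrite mwidenXU.
Qed.

Lemma linform_wide (v : 'rV[k]_n.+1) :
  linform v = mwiden (linform (\row_i v 0 (wide i))) + v 0 top *: 'X_top.
Proof.
rewrite /linform big_ord_recr /= rmorph_sum /=; congr (_ + _); apply: eq_bigr => i _.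
by rewrite mwidenZ mwidenXU mxE.
Qed.

Lemma phi_linform c (v : 'rV[k]_n.+1) :
  phi c (linform v) = linform (\row_i v 0 (wide i) + (v 0 top * c) *: delta_mx 0 u0).
Proof.
by rewrite linform_wide rmorphD /= phi_mwiden psubstZ psubstX hsub_top linformD linformZ linform_delta scalerA.
Qed.

Lemma sqfree_IM C : circuit M C -> in_ideal IM (sqfree k (broken C)).
Proof. by move=> cC; apply: in_ideal_gen; left; exists C. Qed.

Lemma broken_circuit_top C : circuit M C -> top \in C ->
  broken C = top |: wideset (broken (narrow C)).
Proof.
move=> cC tC; apply: broken_top => //; apply/set0Pn; exists u0.
by rewrite mem_narrow wide_u0 -mem_top_circuit.
Qed.

(** Broken circuits of the deletion are broken circuits of [M]; a form of the deletion lifts up to a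
    multiple of [x_top], itself a multiple of [x_u] modulo the ideal. *)
Lemma I1_widen p : in_ideal I1 p -> exists h, in_ideal IM (mwiden p - 'X_u * h).
Proof.
move=> hp; pose G' q := IM q \/ q = 'X_u.
apply: (@in_ideal_adjoin _ _ G').
  move=> g [|->]; first by left.
  by right; exists 1; rewrite mulr1 subrr; apply: in_ideal0.
have MG q : in_ideal IM q -> in_ideal G' q.
  by apply: in_ideal_sub => g Ig; apply: in_ideal_gen; left.
apply: in_ideal_morph hp => g [[C [cC ->]]|[j [jB ->]]] /=.
  by rewrite -[X in mwiden X]/(sqfree k _) mwiden_sqfree -broken_wideset; apply/MG/sqfree_IM; rewrite -circuit1.
rewrite (thetaE sd1P (fun j _ i => erefl (a1 j i)) bB1 jB).
have [cD _ _] := cocP bB1 jB; have [cD' _] := lift1P cD.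
pose v : 'rV_n.+1 := \row_i sd (lift1 (coc N1 B1 j)) i.
have : in_ideal IM (linform v).
  by apply: linformM => C cC; under eq_bigr do rewrite mxE; apply: sorth.
rewrite linform_wide => hv.
have -> : \row_i sd1 (coc N1 B1 j) i = \row_i v 0 (wide i) by apply/rowP => i; rewrite !mxE.
rewrite -[mwiden _](addrK (v 0 top *: 'X_top)); apply: in_idealB; first exact: MG.
apply: in_idealZ; rewrite -[X in in_ideal _ X](subrK (c0 *: 'X_u)); apply: in_idealD.
  exact/MG/Xtop_eqmod.
by apply/in_idealZ/in_ideal_gen; right.
Qed.

(** The factor ['X_u] replaces, up to [c0], the variable [x_top] that a broken circuit through [top]
    loses under contraction. *)
Lemma I2_widen p : in_ideal I2 p -> in_ideal IM ('X_u * mwiden p).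
Proof.
apply: in_ideal_mul_morph => g [[C [/lift2P[cC E] ->]]|[j [jB ->]]] /=.
  rewrite -[X in mwiden X]/(sqfree k _) mwiden_sqfree -E.
  case: (boolP (top \in lift2 C)) => tC; last first.
    by apply: in_idealMl; rewrite -broken_wideset wideset_narrow_id //; apply: sqfree_IM.
  have := sqfree_IM cC; rewrite (broken_circuit_top cC tC) sqfreeU1 ?top_wideset // => h.
  have -> : 'X_u = c0^-1 *: ('X_top - ('X_top - c0 *: 'X_u)) :> {mpoly k[n.+1]}.
    by rewrite subKr scalerA mulVf ?c0_neq0 // scale1r.
  rewrite -scalerAl mulrBl; apply/in_idealZ/in_idealB => //.
  exact/in_idealMr/Xtop_eqmod.
apply: in_idealMl; rewrite (thetaE sd2P (fun j _ i => erefl (a2 j i)) bB2 jB).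
have [cD _ _] := cocP bB2 jB; have cD' := cocircuit2 cD.
pose v : 'rV_n.+1 := \row_i sd (wideset (coc N2 B2 j)) i.
have : in_ideal IM (linform v).
  by apply: linformM => C cC; under eq_bigr do rewrite mxE; apply: sorth.
rewrite linform_wide [v 0 top]mxE (sdP cD' top).1 ?top_wideset // scale0r addr0.
by congr (in_ideal _ (mwiden (linform _))); apply/rowP => i; rewrite !mxE.
Qed.

(** * Spanning and independence *)

Hypothesis H1 : has_NBC_basis k N1 r.
Hypothesis H2 : has_NBC_basis k N2 r.-1.

Lemma NBC_spanning f : exists2 p : {mpoly k[n.+1]},
  (forall mm, mm \in msupp p -> inL M r mm) & in_ideal IM (f - p).
Proof.
have [_ /(_ (phi c0 f)) [p1 L1 hp1]] := H1 admissible1.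
have [h hh] := I1_widen hp1.
have [_ /(_ (phi c0 h)) [p2 L2 hp2]] := H2 admissible2.
exists (mwiden p1 + 'X_u * mwiden p2) => [mm|].
  move/msuppD_le; rewrite mem_cat => /orP[/msupp_mwiden[nu /L1 Lnu ->]|].
    exact: inL1_widen.
  rewrite mulrC (perm_mem (msuppMX _ _)) => /mapP[mm' /msupp_mwiden[nu /L2 Lnu ->] ->].
  by rewrite addmC; apply: inL2_widen.
have -> : f - (mwiden p1 + 'X_u * mwiden p2) =
  (f - mwiden (phi c0 f)) + (mwiden (phi c0 f - p1) - 'X_u * h) +
  ('X_u * (h - mwiden (phi c0 h)) + 'X_u * mwiden (phi c0 h - p2)).
  by rewrite !rmorphB /=; ring.
apply: in_idealD; first by apply: in_idealD => //; apply: mwiden_phi.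
by apply: in_idealD; [apply/in_idealMl/mwiden_phi | apply: I2_widen].
Qed.

Lemma split_L (p : {mpoly k[n.+1]}) : (forall mm, mm \in msupp p -> inL M r mm) ->
  exists p1 p2, [/\ p = mwiden p1 + 'X_u * mwiden p2,
    (forall mm, mm \in msupp p1 -> inL N1 r mm) &
    (forall mm, mm \in msupp p2 -> inL N2 r.-1 mm)].
Proof.
move=> Lp; pose R (mm : 'X_{1..n.+1}) : 'X_{1..n} := [multinom mm (wide i) | i < n].
have RE (mm : 'X_{1..n.+1}) : mm top = 0%N -> mnmwiden (R mm) = mm.
  move=> m0; apply/mnmP => i; have [->|/wideP[j ->]] := eqVneq i top.
    by rewrite mnmwiden_ordmax.
  by rewrite mnmwiden_widen mnmE.
have L0 (mm : 'X_{1..n.+1}) : mm \in msupp p -> mm top = 0%N by move/Lp/inLP => [h _]; apply/h/top_B.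
have RU (mm : 'X_{1..n.+1}) : mm \in msupp p -> mm u != 0%N ->
    (mnmwiden (R (mm - U_(u))) + U_(u))%MM = mm.
  move=> mp mu; rewrite RE ?submK ?lep1mP // mnmBE L0 //.
exists (\sum_(mm <- msupp p | mm u == 0%N) p@_mm *: 'X_[R mm]).
exists (\sum_(mm <- msupp p | mm u != 0%N) p@_mm *: 'X_[R (mm - U_(u))%MM]); split.
- rewrite {1}[p]mpolyE (bigID (fun mm : 'X_{1..n.+1} => mm u == 0%N)) /=.
  rewrite !rmorph_sum mulr_sumr /=; congr (_ + _).
    rewrite big_seq_cond [RHS]big_seq_cond; apply: eq_bigr => mm /andP[mp _].
    by rewrite mwidenZ mwidenX RE // L0.
  rewrite big_seq_cond [RHS]big_seq_cond; apply: eq_bigr => mm /andP[mp mu].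
  by rewrite mwidenZ mwidenX -scalerAr -mpolyXD addmC RU.
- move=> _ /msupp_sumX[mm [mp /eqP mu ->]]; apply: inL1_restr.
    by rewrite RE ?L0 // Lp.
  by rewrite mnmE wide_u0.
- by move=> _ /msupp_sumX[mm [mp mu ->]]; apply: inL2_restr; rewrite RU // Lp.
Qed.

Lemma phi0_IM p : in_ideal IM p -> in_ideal I1 (phi 0 p).
Proof.
apply: in_ideal_morph => g [[C [cC ->]]|[j [jB ->]]].
  rewrite /= -[X in psubst _ X]/(sqfree k _); case: (boolP (top \in C)) => tC.
    rewrite (broken_circuit_top cC tC) sqfreeU1 ?top_wideset // rmorphM /= psubstX hsub_top.
    by rewrite scale0r mul0r; apply: in_ideal0.
  rewrite -(wideset_narrow_id tC) broken_wideset -mwiden_sqfree phi_mwiden.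
  by apply: in_ideal_gen; left; exists (narrow C); rewrite circuit_wideset.
rewrite (thetaE sdP aP bB jB) /= phi_linform mulr0 scale0r addr0; apply: lf1 => C.
rewrite circuit1 => cC; have [cD _ _] := cocP bB jB; have := sorth cC cD.
rewrite sum_wide (scP cC top).1 ?top_wideset // mul0r addr0 => E; rewrite -[RHS]E.
by apply: eq_bigr => i _; rewrite !mxE.
Qed.

(** [u0] lies in no circuit of the deletion, so its unit vector is orthogonal to all of them. *)
Lemma Xu0_I1 : in_ideal I1 'X_u0.
Proof.
rewrite -linform_delta; apply: lf1 => C cC; rewrite big1 // => i _; rewrite mxE eqxx /=.
case: eqP => [->|_]; last by rewrite mulr0.
by rewrite (sc1P cC u0).1 ?mul0r // u0_circuit1.
Qed.

Definition signed_rel (z : 'rV[k]_n.+1) : Prop :=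
  forall D, cocircuit M D -> \sum_e z 0 e * sd D e = 0.
(** Padded with zero rows, so that rows are indexed by the ground set and the row space is the span
    of [Theta]. *)
Definition theta_mx : 'M[k]_n.+1 := \matrix_(j, i) (if j \in B then sd (coc M B j) i else 0).

Lemma signed_rel_sc C : circuit M C -> signed_rel (\row_i sc C i).
Proof. by move=> cC D cD; under eq_bigr do rewrite mxE; apply: sorth. Qed.

Lemma orth_theta_mx : orth signed_rel theta_mx.
Proof.
move=> z Kz; apply/sub_kermxP/matrixP => j i; rewrite ord1 !mxE.
have [jB|jB] := boolP (j \in B); last first.
  by rewrite big1 // => e _; rewrite !mxE (negbTE jB) mul0r.
have [cD _ _] := cocP bB jB; rewrite -[RHS](Kz _ cD); apply: eq_bigr => e _.
by rewrite !mxE jB mulrC.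
Qed.

Lemma noloop_top : noloop signed_rel top.
Proof.
move=> z Kz z0; apply/eqP; apply: contraT => /(relation_dep sdP Kz) /negP[].
have [NB _] := mbasisP _ _ bB; apply: Msub NB; apply/subsetP => i iz.
have [->|it] := eqVneq i top; first exact: top_B.
have := vsupp_drop top z; rewrite z0 => /setP/(_ i); rewrite in_setD1 it iz.
by rewrite inE mxE eqxx.
Qed.

(** The fundamental circuit of [u] contains [top] with nonzero sign, so [x_top] is not orthogonal to
    its relation. *)
Lemma top_notin_theta_mx : ~~ ((delta_mx 0 top : 'rV[k]_n.+1) <= theta_mx)%MS.
Proof.
apply/negP => tU; have [cC _ uC] := ciP Msub bB u_notin_B.
have /sub_kermxP := submx_trans tU (orth_theta_mx (signed_rel_sc cC)).
rewrite -rowE => /matrixP/(_ 0 0); rewrite !mxE => /eqP.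
by rewrite -[_ == _]negbK (sc_neq0 scP) // mem_top_circuit // uC.
Qed.

Lemma IM_bclin_gens p : in_ideal IM p -> in_ideal (bclin_gens signed_rel n.+1 theta_mx) p.
Proof.
apply: in_ideal_sub => g [[C [cC ->]]|[j [jB ->]]]; apply: in_ideal_gen.
  left; exists (\row_i sc C i).
  have E : vsupp (\row_i sc C i) = C by apply/setP => i; rewrite inE mxE (sc_neq0 scP).
  split; [exact: signed_rel_sc | | by move=> i _; apply: ltn_ord | by rewrite E].
  rewrite -vsupp_eq0 E; have [NC _] := circuitP _ _ cC; apply: contra NC => /eqP->.
  by case: mM.
right; exists (row j theta_mx); first exact: row_sub.
rewrite (thetaE sdP aP bB jB); congr linform; apply/rowP => i.
by rewrite !mxE jB.
Qed.

(** The support of a relation contains a circuit, whose broken set divides the generator. For forms,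
    [phi c0] moves the coefficient at [top] to [u0] with the factor [c0], exactly the ratio of the
    signs of a circuit at [top] and [u], so orthogonality survives. *)
Lemma bclin_gens_I2 p : in_ideal (bclin_gens (contract_rel signed_rel top) n theta_mx) p -> in_ideal I2 (phi c0 p).
Proof.
apply: in_ideal_morph => g [[z' [[z Kz E] nz _ ->]]|[v vU ->]] /=.
  have {}nz : z != 0.
    by apply: contra_neq nz => z0; rewrite E z0 /drop_coord mxE scale0r subr0.
  have [C cC CS] := dep_circuit (relation_dep sdP Kz nz).
  rewrite E vsupp_drop -wideset_narrow broken_wideset -mwiden_sqfree phi_mwiden.
  have sub : broken (narrow C) \subset broken (narrow (vsupp z)).
    by apply/broken_sub/subsetP => i; rewrite !mem_narrow; apply: (subsetP CS).
  have [q ->] := sqfree_sub k sub; apply: in_idealMl; apply: in_ideal_gen; left.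
  by exists (narrow C); rewrite circuit2_narrow.
rewrite phi_linform; apply: lf2 => C /lift2P[cC _]; rewrite /sc2; set C' := lift2 C in cC *.
have /sub_kermxP := submx_trans vU (orth_theta_mx (signed_rel_sc cC)).
move/matrixP/(_ 0 0); rewrite !mxE sum_wide !mxE => vC.
have := sorth cC cU; rewrite (bigD1 top) //= (bigD1 u) ?u_top //= big1 ?addr0.
  move=> /eqP; rewrite addr_eq0 => /eqP uC.
  (* Orthogonality of the circuit to [[set top; u]]. *)
  have tC : sc C' top = c0 * sc C' u.
    by apply: (mulIf sd_top_neq0); rewrite uC /c0 mulrAC divfK ?sd_top_neq0 // mulNr mulrC.
  under eq_bigr do rewrite !mxE eqxx /= mulrDr.
  rewrite big_split /= [X in _ + X](bigD1 u0) //= eqxx mulr1 [X in _ + (_ + X)]big1 ?addr0 => [|i /negbTE->].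
    rewrite wide_u0 -[RHS]vC tC; congr (_ + _); last by ring.
    by apply: eq_bigr => i _; rewrite !mxE mulrC.
  by rewrite !mulr0.
move=> i /andP[it iu]; rewrite (sdP cU i).1 ?mulr0 // !inE.
by rewrite (negbTE it) (negbTE iu).
Qed.

Lemma NBC_independence (p : {mpoly k[n.+1]}) :
  (forall mm, mm \in msupp p -> inL M r mm) -> in_ideal IM p -> p = 0.
Proof.
move=> /split_L[p1 [p2 [-> L1 L2]]] hp.
have p10 : p1 = 0.
  have [h _] := H1 admissible1; apply: h => //.
  (* With [x_top] set to [0], the second summand becomes a multiple of ['X_u0], which lies in the
     ideal of the deletion; only [p1] is left. *)
  have := phi0_IM hp; rewrite rmorphD rmorphM /= !phi_mwiden psubstX -wide_u0 hsub_wide => h'.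
  rewrite -[p1](addrK ('X_u0 * p2)); apply: in_idealB => //.
  exact/in_idealMr/Xu0_I1.
rewrite p10 rmorph0 add0r in hp *; suff -> : p2 = 0 by rewrite rmorph0 mulr0.
have [h _] := H2 admissible2; apply: h => //.
rewrite -(phi_mwiden c0 p2); apply: bclin_gens_I2.
apply: (colon_last_variable (e := top) erefl (@linear_nzd_all k n.+1 n (leqnSn n)) noloop_top orth_theta_mx
  top_notin_theta_mx).
(* The colon result concerns the last variable, so ['X_u] is traded for ['X_top] at the price of the
   scalar [c0]. *)
apply: IM_bclin_gens; rewrite -['X_top](subrK (c0 *: 'X_u)) mulrDl; apply: in_idealD.
  exact/in_idealMr/Xtop_eqmod.
by rewrite -scalerAl; apply: in_idealZ.
Qed.

End Minors.

(* Ground set e_1 < ... < e_{n+1} is 'I_n.+1 (so the paper's n is n+1 here). *)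
Theorem theorem4p6 (k : fieldType) (n r : nat) (M : {set 'I_n.+1} -> bool) :
  is_matroid M -> regular M ->
  (0 < r)%N -> (r <= n)%N ->
  mbasis M (Bst n.+1 r) ->
  cocircuit M [set ord_max; inord (n - r)] ->
  has_NBC_basis k (del_last M) r ->
  has_NBC_basis k (con_last M) r.-1 ->
  has_NBC_basis k M r.
Proof.
move=> mM _ r0 rn bB cU H1 H2 a [sc [sd [scP sdP sorth aP]]]; split.
  exact: (NBC_independence mM r0 rn bB cU scP sdP sorth aP H1 H2).
exact: (NBC_spanning mM r0 rn bB cU scP sdP sorth aP H1 H2).
Qed.
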